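(* Let $\mathcal{O}$ be a finitely generated, local, reduced and complete one-dimensional $k$-algebra (the ring of an algebroid curve) with $r$ minimal primes, $I=\{1,\dots,r\}$, and semigroup of values $S$. The following statements are equivalent: (i) for every fractional ideal $\mathcal{I}$ of $\mathcal{O}$, $$\ell\left(\frac{\mathcal{I}(\alpha)}{\mathcal{I}(\alpha+e_i)}\right)+\ell\left(\frac{\mathcal{I}^*(c(S)-\alpha-e_i)}{\mathcal{I}^*(c(S)-\alpha)}\right)=1\quad\text{for every }\alpha\in\mathbb{Z}^r\text{ and } i\in I;$$ (ii) $\mathcal{O}$ is a Gorenstein ring.
   Context: $\mathbb{N}$ denotes the non-negative integers. The ring of an algebroid curve is a local, reduced, complete $k$-algebra $\mathcal{O}$ of pure dimension one, finitely generated as a complete $k$-algebra (i.e. a quotient of some $k[[X_1,\dots,X_n]]$), where $k$ is an algebraically closed coefficient field of $\mathcal{O}$. Let $\wp_1,\dots,\wp_r$ be its minimal primes, $\mathcal{O}_i=\mathcal{O}/\wp_i$, and $\mathcal{K}_i$ the fraction field of $\mathcal{O}_i$. The integral closure of $\mathcal{O}_i$ in $\mathcal{K}_i$ is isomorphic to $k[[t_i]]$, so $\mathcal{K}_i\simeq k((t_i))$ with its normalized valuation $v_i$ ($v_i(0)=\infty$). Let $\mathcal{K}\simeq\mathcal{K}_1\times\cdots\times\mathcal{K}_r$ be the total ring of fractions of $\mathcal{O}$, $\pi_i:\mathcal{K}\to\mathcal{K}_i$ the projections, $Z(\mathcal{K})$ the set of elements of $\mathcal{K}$ with some zero component, $\widetilde{\mathcal{O}}$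 the integral closure of $\mathcal{O}$ in $\mathcal{K}$, and $v:\mathcal{K}\setminus Z(\mathcal{K})\to\mathbb{Z}^r$, $v(h)=(v_1(\pi_1(h)),\dots,v_r(\pi_r(h)))$. $\mathcal{O}$ is Gorenstein if $\dim_k\mathcal{O}/\mathcal{C}=\dim_k\widetilde{\mathcal{O}}/\mathcal{O}$, where $\mathcal{C}=\{h\in\mathcal{K}: h\widetilde{\mathcal{O}}\subset\mathcal{O}\}$. A fractional ideal of $\mathcal{O}$ is an $\mathcal{O}$-submodule $\mathcal{I}$ of $\mathcal{K}$ containing a regular element of $\mathcal{O}$ and such that $d\,\mathcal{I}\subset\mathcal{O}$ for some regular $d\in\mathcal{O}$. Its dual is the fractional ideal $\mathcal{I}^*=\{x\in\mathcal{K}: x\mathcal{I}\subset\mathcal{O}\}$. For $\alpha\in\mathbb{Z}^r$, $\mathcal{I}(\alpha)=\{h\in\mathcal{I}: v_i(\pi_i(h))\ge\alpha_i\ \forall i\}$, and similarly for $\mathcal{I}^*$. $\ell$ denotes length as $\mathcal{O}$-module, and $e_i\in\mathbb{Z}^r$ is the $i$-th standard basis vector. $S=v(\mathcal{O}\setminus Z(\mathcal{K}))$; with the componentwise order on $\mathbb{Z}^r$, the conductor $c(S)$ is the unique least $\gamma\in S$ with $\gamma+\mathbb{N}^r\subset S$. *)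

(* Defs.v *)
From HB Require Import structures.
From mathcomp Require Import all_boot all_order all_algebra.
From mathcomp Require Import boolp classical_sets constructive_ereal.
(* The notations of mpoly clash with those of constructive_ereal. *)
From mathcomp Require Import -(notations) mpoly.

Set Implicit Arguments.
Unset Strict Implicit.
Unset Printing Implicit Defensive.

Import Order.TTheory GRing.Theory Num.Theory.
Local Open Scope classical_set_scope.
Local Open Scope ring_scope.

Section PowerSeries.
Variable n : nat.

(* R[[X_1, ..., X_n]]; a series is its family of coefficients. *)
Record fps (R : Type) := Fps { fcoef : multinom n -> R }.

Lemma fpsP (R : Type) (f g : fps R) : fcoef f =1 fcoef g -> f = g.
Proof. by case: f g => [f] [g] /= /funext ->. Qed.

HB.instance Definition _ (R : Type) := gen_eqMixin (fps R).
HB.instance Definition _ (R : Type) := gen_choiceMixin (fps R).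

Section Ring.
Variable R : comNzRingType.
Implicit Types f g h : fps R.

Definition fps_zero := Fps (fun _ => 0 : R).
Definition fps_opp f := Fps (fun m => - fcoef f m).
Definition fps_add f g := Fps (fun m => fcoef f m + fcoef g m).

Lemma fps_addA : associative fps_add.
Proof. by move=> f g h; apply: fpsP => m /=; rewrite addrA. Qed.
Lemma fps_addC : commutative fps_add.
Proof. by move=> f g; apply: fpsP => m /=; rewrite addrC. Qed.
Lemma fps_add0 : left_id fps_zero fps_add.
Proof. by move=> f; apply: fpsP => m /=; rewrite add0r. Qed.
Lemma fps_addN : left_inverse fps_zero fps_opp fps_add.
Proof. by move=> f; apply: fpsP => m /=; rewrite addNr. Qed.

HB.instance Definition _ :=
  GRing.isZmodule.Build (fps R) fps_addA fps_addC fps_add0 fps_addN.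

Definition fps_const (c : R) :=
  Fps (fun m => if m == mnm0 then c else 0).

Definition fps_mul f g := Fps (fun m =>
  \sum_(a : bmultinom n (mdeg m).+1 | lem (bmnm a) m)
    fcoef f (bmnm a) * fcoef g (mnm_sub m (bmnm a))).

Let trunc d f : mpoly n R :=
  \sum_(a : bmultinom n d)
     fcoef f (bmnm a) *: mpolyX R (bmnm a).

Let truncE d f m : (mdeg m < d)%N ->
  mcoeff m (trunc d f) = fcoef f m.
Proof.
move=> lt_md; rewrite raddf_sum /= (bigD1 (BMultinom lt_md)) //=.
rewrite mcoeffZ mcoeffX eqxx mulr1 big1 ?addr0 // => a ne_a.
rewrite mcoeffZ mcoeffX; case: eqP => [e|]; last by rewrite mulr0.
by case/eqP: ne_a; apply: val_inj.
Qed.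

Let lem_mdeg (a m : multinom n) : lem a m ->
  (mdeg a <= mdeg m)%N.
Proof. by move/lem_leo/lemc_mdeg. Qed.

Let mdeg_sub (m a : multinom n) :
  (mdeg (mnm_sub m a) <= mdeg m)%N.
Proof. by apply: lem_mdeg; apply: lem_subr. Qed.

Let mulE d f g m : (mdeg m < d)%N ->
  fcoef (fps_mul f g) m = mcoeff m (trunc d f * trunc d g).
Proof.
move=> lt_md; rewrite (@mcoeff_poly_mul_lin _ _ _ _ m _ (ltnSn _)).
apply: eq_bigr => a /lem_mdeg le_am; rewrite !truncE //.
  by apply: leq_ltn_trans lt_md; apply: mdeg_sub.
by apply: leq_ltn_trans lt_md.
Qed.

Let eq_coefM (p p' q q' : mpoly n R) m :
  (forall a, (mdeg a <= mdeg m)%N ->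
     mcoeff a p = mcoeff a p') ->
  (forall a, (mdeg a <= mdeg m)%N ->
     mcoeff a q = mcoeff a q') ->
  mcoeff m (p * q) = mcoeff m (p' * q').
Proof.
move=> ep eq; rewrite !(@mcoeff_poly_mul_lin _ _ _ _ m _ (ltnSn _)).
by apply: eq_bigr => a /lem_mdeg le_am; rewrite ep // eq // mdeg_sub.
Qed.

Lemma fps_mulA : associative fps_mul.
Proof.
move=> f g h; apply: fpsP => m; rewrite !(mulE _ _ (ltnSn _)).
transitivity (mcoeff m (trunc (mdeg m).+1 f *
  (trunc (mdeg m).+1 g * trunc (mdeg m).+1 h))).
  by apply: eq_coefM => // a le_am; rewrite truncE // (@mulE (mdeg m).+1).
rewrite mulrA; apply: eq_coefM => // a le_am.
by rewrite truncE // (@mulE (mdeg m).+1).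
Qed.

Lemma fps_mulC : commutative fps_mul.
Proof.
by move=> f g; apply: fpsP => m; rewrite !(mulE _ _ (ltnSn _)) mulrC.
Qed.

Lemma fps_mulCE c f m : fcoef (fps_mul (fps_const c) f) m = c * fcoef f m.
Proof.
rewrite (mulE _ _ (ltnSn _)).
rewrite (@eq_coefM _ (mpolyC n c) _ (trunc (mdeg m).+1 f) m) //.
  by rewrite mcoeffCM truncE.
move=> a le_am; rewrite truncE // mcoeffC /=.
by case: eqP; rewrite ?mulr1 ?mulr0.
Qed.

Lemma fps_mul1 : left_id (fps_const 1) fps_mul.
Proof. by move=> f; apply: fpsP => m; rewrite fps_mulCE mul1r. Qed.

Lemma fps_mulDl : left_distributive fps_mul fps_add.
Proof.
move=> f g h; apply: fpsP => m /=; rewrite -big_split /=.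
by apply: eq_bigr => a _; rewrite mulrDl.
Qed.

Lemma fps_one_neq0 : fps_const 1 != 0.
Proof.
apply/eqP => /(congr1 (fun f => fcoef f mnm0)) /=.
by rewrite eqxx => /eqP; rewrite oner_eq0.
Qed.

HB.instance Definition _ := GRing.Zmodule_isComNzRing.Build (fps R)
  fps_mulA fps_mulC fps_mul1 fps_mulDl fps_one_neq0.

Definition fps_scale (c : R) f := Fps (fun m => c * fcoef f m).

Lemma fps_scaleA c d f : fps_scale c (fps_scale d f) = fps_scale (c * d) f.
Proof. by apply: fpsP => m /=; rewrite mulrA. Qed.
Lemma fps_scale1 : left_id 1 fps_scale.
Proof. by move=> f; apply: fpsP => m /=; rewrite mul1r. Qed.
Lemma fps_scaleDr : right_distributive fps_scale +%R.
Proof. by move=> c f g; apply: fpsP => m /=; rewrite mulrDr. Qed.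
Lemma fps_scaleDl f : {morph fps_scale^~ f : c d / c + d}.
Proof. by move=> c d; apply: fpsP => m /=; rewrite mulrDl. Qed.

HB.instance Definition _ := GRing.Zmodule_isLmodule.Build R (fps R)
  fps_scaleA fps_scale1 fps_scaleDr fps_scaleDl.

Lemma fps_scaleAl (c : R) (f g : fps R) : c *: (f * g) = (c *: f) * g.
Proof.
apply: fpsP => m /=; rewrite mulr_sumr.
by apply: eq_bigr => a _; rewrite mulrA.
Qed.

HB.instance Definition _ := GRing.Lmodule_isLalgebra.Build R (fps R)
  fps_scaleAl.
HB.instance Definition _ := GRing.Lalgebra_isComAlgebra.Build R (fps R).

Definition fps_unit : pred (fps R) := fun f => `[< exists g, g * f = 1 >].
Definition fps_inv (f : fps R) : fps R :=
  if fps_unit f then xget 0 [set g | g * f = 1] else f.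

Lemma fps_mulVf : {in fps_unit, left_inverse 1 fps_inv *%R}.
Proof.
move=> f uf; have /asboolP [g gf] : fps_unit f by exact: uf.
rewrite /fps_inv ifT //.
by have := @xgetI _ 0 [set g | g * f = 1] _ gf.
Qed.
Lemma fps_unitP (f g : fps R) : g * f = 1 -> f \in fps_unit.
Proof. by move=> gf; apply/asboolP; exists g. Qed.
Lemma fps_inv_out : {in [predC fps_unit], fps_inv =1 id}.
Proof. by move=> f uf; rewrite /fps_inv ifN. Qed.

HB.instance Definition _ := GRing.ComNzRing_hasMulInverse.Build (fps R)
  fps_mulVf fps_unitP fps_inv_out.

End Ring.

Lemma fps_idomain (R : idomainType) (f g : fps R) :
  f * g = 0 -> (f == 0) || (g == 0).
Proof.
have least (h : fps R) : h != 0 -> exists m, fcoef h m != 0 /\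
    forall m', fcoef h m' != 0 -> (m <= m')%O.
  move=> h0; case: (pselect (exists m, fcoef h m != 0)) => [[m hm]|no]; last first.
    case/eqP: h0; apply: fpsP => m /=; apply/eqP/negP => /negP hm.
    by apply: no; exists m.
  elim/(@ltmwf n): m hm => m ih hm.
  case: (pselect (exists2 m', fcoef h m' != 0 & (m' < m)%O)) => [[m' hm' lt]|no].
    exact: ih lt hm'.
  exists m; split=> // m' hm'; rewrite leNgt; apply/negP => lt.
  by apply: no; exists m'.
move=> fg; apply/orP; case: (eqVneq f 0) => [|f0]; [by left|].
case: (eqVneq g 0) => [|g0]; [by right|].
have [a [fa lea]] := least f f0; have [b [gb leb]] := least g g0.
pose m := mnm_add a b.
have /eqP := congr1 (fun h => fcoef h m) fg => /=.
have lt_a : (mdeg a < (mdeg m).+1)%N.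
  by rewrite ltnS; apply/lemc_mdeg/lem_leo; rewrite lem_addr.
rewrite (bigD1 (BMultinom lt_a)) /= ?lem_addr //.
rewrite big1 => [|c /andP[le_cm ne_ca]].
  rewrite addr0 /m addmC addmK mulf_eq0.
  by rewrite (negbTE fa) (negbTE gb).
apply/eqP; rewrite mulf_eq0; apply/negP => /negP; rewrite negb_or.
case/andP => /lea le_ac /leb le_b.
have ne_ac : (a < bmnm c)%O.
  rewrite lt_neqAle le_ac andbT; apply: contra ne_ca => /eqP e.
  by apply/eqP/val_inj; rewrite /= e.
have := lemc_lt_add le_b ne_ac.
by rewrite submK // addmC ltxx.
Qed.

HB.instance Definition _ (R : idomainType) :=
  GRing.ComUnitRing_isIntegral.Build (fps R) (@fps_idomain R).

End PowerSeries.

Section Laurent.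
Variable k : fieldType.

(* Order of a nonzero power series (least degree of a monomial of f). *)
Definition fps_ord n (f : fps n k) : nat :=
  xget 0%N [set d | (exists2 m, fcoef f m != 0 & mdeg m = d) /\
                    forall m, fcoef f m != 0 -> (d <= mdeg m)%N].

(* k((t)) *)
Definition laurent : fieldType := {fraction (fps 1 k)}.

Definition laurent_val (x : laurent) : \bar int :=
  if x == 0 then +oo%E
  else ((fps_ord \n_(repr x))%:Z - (fps_ord \d_(repr x))%:Z)%:E.

End Laurent.

Section Ideals.
Variable R : comNzRingType.
Implicit Types P Q M J : set R.

(* [idealr_closed] already requires ideals to be proper. *)
Definition maximal_ideal M :=
  idealr_closed [in M] /\
  forall J, idealr_closed [in J] -> M `<=` J -> J = M.

Definition prime_ideal P := idealr_closed [in P] /\ prime_idealr_closed [in P].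

Definition minimal_prime P :=
  prime_ideal P /\ forall Q, prime_ideal Q -> Q `<=` P -> Q = P.

(* P = c 0 < c 1 < ... < c d: a chain of length d of primes of R/P *)
Definition prime_chain P d := exists c : nat -> set R,
  [/\ c 0%N = P, forall j, (j <= d)%N -> prime_ideal (c j)
    & forall j, (j < d)%N -> c j `<` c j.+1].

Definition pure_dimension d := forall P, minimal_prime P ->
  prime_chain P d /\ ~ prime_chain P d.+1.

Fixpoint ideal_pow J n : set R :=
  if n is n'.+1 then
    [set x | exists2 s : seq (R * R),
       forall p, p \in s -> J p.1 /\ ideal_pow J n' p.2
       & x = \sum_(p <- s) p.1 * p.2]
  else setT.

(* The canonical map from R to the inverse limit of the R/J^n is bijective. *)
Definition adically_complete J := forall u : nat -> R,
  (forall n, ideal_pow J n (u n.+1 - u n)) ->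
  exists! l, forall n, ideal_pow J n (l - u n).

End Ideals.

Section Curve.
Variables (k : closedFieldType) (O : comAlgType k).

(* Being a quotient of some k[[X_1, ..., X_n]] already makes O local and
   complete with coefficient field k; these properties are listed anyway. *)
Record algebroid_curve : Prop := AlgebroidCurve {
  curve_local_complete : exists M : set O,
    [/\ forall J, maximal_ideal J <-> J = M,
        forall x, exists c : k, M (x - c%:A)
      & adically_complete M];
  curve_reduced : forall (x : O) n, x ^+ n = 0 -> x = 0;
  curve_dimension : pure_dimension O 1;
  curve_finitely_generated : exists (n : nat) (phi : {lrmorphism fps n k -> O}),
    forall x, exists f, phi f = x }.

Definition minimal_primes_enum r (P : 'I_r -> set O) :=
  injective P /\ forall Q, minimal_prime Q <-> exists i, P i = Q.

Section TotalFractions.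
Variables (K : comUnitRingType) (iota : {rmorphism O -> K}).
Implicit Types I M N : set K.

Definition total_fraction_ring :=
  [/\ injective iota,
      forall s, GRing.lreg s -> iota s \is a GRing.unit
    & forall x, exists a s, GRing.lreg s /\ x = iota a / iota s].

Definition integral_closure : set K := [set x | integralOver iota x].

Definition submodule M :=
  [/\ M 0, forall x y, M x -> M y -> M (x + y)
    & forall a x, M x -> M (iota a * x)].

Definition fractional_ideal I :=
  [/\ submodule I,
      exists2 a, GRing.lreg a & I (iota a)
    & exists2 d, GRing.lreg d & forall x, I x -> range iota (iota d * x)].

Definition dual I : set K := [set x | forall y, I y -> range iota (x * y)].

Definition conductor_ideal : set K :=
  [set h | forall y, integral_closure y -> range iota (h * y)].

(* The element of A, when A has exactly one; +oo when A is empty. *)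
Definition nat_or_oo (A : set nat) : \bar int :=
  if `[< A !=set0 >] then (xget 0%N A)%:Z%:E else +oo%E.

(* Submodules of M/N are identified with submodules between N and M. *)
Definition strict_chain M N n := exists c : nat -> set K,
  [/\ c 0%N = N, c n = M, forall j, (j <= n)%N -> submodule (c j)
    & forall j, (j < n)%N -> c j `<` c j.+1].

Definition quotient_length M N : \bar int :=
  nat_or_oo [set n | strict_chain M N n /\
                     forall m, strict_chain M N m -> (m <= n)%N].

(* b lifts a k-basis of M/N *)
Definition quotient_basis M N n (b : 'I_n -> K) :=
  (forall j, M (b j)) /\
  forall x, M x -> exists! c : {ffun 'I_n -> k},
    N (x - \sum_(j < n) iota (c j)%:A * b j).

Definition quotient_dim M N : \bar int :=
  nat_or_oo [set n | exists b : 'I_n -> K, quotient_basis M N b].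

Definition gorenstein :=
  quotient_dim (range iota) conductor_ideal =
  quotient_dim integral_closure (range iota).

Section Values.
Variables (r : nat) (v : 'I_r -> K -> \bar int).

Definition filtration I (alpha : {ffun 'I_r -> int}) : set K :=
  [set h | I h /\ forall i, ((alpha i)%:E <= v i h)%E].

Definition std_basis (i : 'I_r) : {ffun 'I_r -> int} :=
  [ffun j => (j == i)%:R].

(* The values on elements with no zero component are finite. *)
Definition value_semigroup (Ki : 'I_r -> fieldType)
    (prj : forall i, {rmorphism K -> Ki i}) : set {ffun 'I_r -> int} :=
  [set alpha | exists2 a : O, ~ (exists i, prj i (iota a) = 0)
                            & forall i, v i (iota a) = (alpha i)%:E].

End Values.

End TotalFractions.

(* f presents the field F as the field of fractions of O/P. *)
Definition fraction_field_mod (P : set O) (F : fieldType)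
    (f : {rmorphism O -> F}) :=
  (forall a, f a = 0 <-> P a) /\
  forall x, exists a b, f b != 0 /\ x = f a / f b.

(* psi is a k-isomorphism of F with k((t)) carrying the integral closure of
   f(O) in F onto k[[t]]. *)
Definition normalization_iso (F : fieldType) (f : {rmorphism O -> F})
    (psi : {rmorphism F -> laurent k}) :=
  [/\ bijective psi,
      forall c : k, psi (f c%:A) = tofrac (c%:A : fps 1 k)
    & forall x, integralOver f x <-> range (@tofrac (fps 1 k)) (psi x)].

Definition is_conductor r (S : set {ffun 'I_r -> int})
    (gamma : {ffun 'I_r -> int}) :=
  let above g := S g /\
    forall n : {ffun 'I_r -> nat}, S [ffun i => g i + (n i)%:Z] in
  above gamma /\ forall g, above g -> forall i, gamma i <= g i.

Definition conductor r (S : set {ffun 'I_r -> int}) : {ffun 'I_r -> int} :=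
  xget 0 [set gamma | is_conductor S gamma].

End Curve.

(* Main.v *)
Require Import Defs.
From HB Require Import structures.
From mathcomp Require Import all_boot all_order all_algebra.
From mathcomp Require Import boolp classical_sets constructive_ereal.
From mathcomp Require Import -(notations) mpoly.
From mathcomp Require Import zify ring.

Set Implicit Arguments.
Unset Strict Implicit.
Unset Printing Implicit Defensive.

Import Order.TTheory GRing.Theory Num.Theory.
Local Open Scope classical_set_scope.
Local Open Scope ring_scope.

(** Let [R] be the image of [O] in [K], and let [full a] be the set of elements
    of [K] with values at least [a]. A subspace [X] of [K] jumps at [a] in
    direction [i] when it contains an element of [full a] with value exactly
    [a i] at [i]. As the residue field is [k], the length of [X(a) / X(a + e_i)]
    is [1] or [0] according to whether [X] jumps there
    ([quotient_length_step]), and the equation to study says that exactly one of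
    [X] at [a] and [dual X] at the mirror place [c - a - e_i] jumps.

    They cannot both jump: the product of the two elements would lie in [R], with
    value [c i - 1] at [i] and at least [c j] at the other places, against the
    minimality of the conductor [c] ([jump_dual]). Hence, along any lattice path,
    the jumps of [X] and those of [dual X] on the mirror path add up to at most
    the length of the path. As the jumps of [X] along a path count the dimension
    of the quotient of [X] between its ends ([basis_jumps]), on a path from [0] to
    [c] the dimension of [O] modulo its conductor is the number of jumps of [R],
    and that of the integral closure modulo [O] is the number of the other steps.
    So [O] is Gorenstein if and only if [R] jumps at exactly half of the steps
    ([gorensteinP]). This follows from the equation for [X = R] by summation over
    the path, because [R] is its own dual and the mirror path joins the same ends.

    Conversely, let [R] jump at half of the steps. The inequality above for the
    maximal ideal [m] then shows that [dual m / R] has dimension at most one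
    ([dual_max_ideal_one_generator]). For a fractional ideal [X], consider its
    truncations along a long path. When [X] does not jump, the next truncation is
    the same; when it does, the truncation loses one generator, and its dual gains
    at most one dimension, since multiplication by that generator embeds the
    gain in [dual m / R] ([dual_one_generator]). The last truncation is some
    [full b], whose dual [full (c - b)] jumps everywhere; therefore the jumps of
    [X] and [dual X] are at least as many as the steps, and the equation holds
    at each of them ([jump_dual_symmetric]).

    This needs [K] to be the product of the fields [k((t_i))], the integral
    closure of [O] to be [full 0], and [c] to exist. The first two hold because
    the minimal primes of the reduced ring [O] intersect in [0] and can be
    separated by elements of [O] ([curve_product_valuation],
    [integral_closureE]). For the third, choose a regular [x] in [m]: the quotient
    [full 0 / x (full 0)] has finite dimension over [k], and completeness lifts a
    basis of it to generators of [full 0] over [R] ([closure_finite]); a common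
    denominator of these multiplies [full 0] into [R]. *)

(** * Power series in one variable *)

Section PowerSeriesOrder.
Variable k : fieldType.
Implicit Types (f g : fps 1 k) (m : multinom 1).

Definition tmon (d : nat) : multinom 1 := mnm_muln (mnm1 ord0) d.

Lemma mdeg_tmon d : mdeg (tmon d) = d.
Proof. by rewrite /tmon mdegMn mdeg1 mul1n. Qed.

Lemma tmon_mdeg m : tmon (mdeg m) = m.
Proof.
apply/mnmP => i; rewrite /tmon mulmnE mnm1E [i]ord1 eqxx mul1n.
by rewrite mdegE big_ord1.
Qed.

Lemma lem_tmon d m : (d <= mdeg m)%N -> lem (tmon d) m.
Proof.
move=> le_dm; apply/mnm_lepP => i; rewrite /tmon mulmnE mnm1E [i]ord1 eqxx mul1n.
by move: le_dm; rewrite mdegE big_ord1.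
Qed.

Lemma mdeg_mnm_sub (a m : multinom 1) :
  lem a m -> (mdeg a + mdeg (mnm_sub m a) = mdeg m)%N.
Proof. by move=> le_am; rewrite -mdegD addmC submK. Qed.

Definition fps_ge (d : nat) f := forall m, (mdeg m < d)%N -> fcoef f m = 0.

Lemma fps_ge_mul a b f g : fps_ge a f -> fps_ge b g -> fps_ge (a + b)%N (f * g).
Proof.
move=> fa gb m lt_m /=; apply: big1 => c le_cm.
have e := mdeg_mnm_sub le_cm.
have [lt_c|le_c] := ltnP (mdeg (bmnm c)) a; first by rewrite fa ?mul0r.
rewrite gb ?mulr0 //; lia.
Qed.

(** In one variable there is a single monomial of each degree, so the lowest
    term of a product is the product of the lowest terms. *)
Lemma fcoef_mul_low a b f g : fps_ge a f -> fps_ge b g ->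
  fcoef (f * g) (tmon (a + b)) = fcoef f (tmon a) * fcoef g (tmon b).
Proof.
move=> fa gb /=; set m := tmon (a + b).
have dm : mdeg m = (a + b)%N by exact: mdeg_tmon.
have lt_a : (mdeg (tmon a) < (mdeg m).+1)%N by rewrite mdeg_tmon dm; lia.
have le_am : lem (tmon a) m by apply: lem_tmon; rewrite dm; lia.
rewrite (bigD1 (BMultinom lt_a)) //= big1 ?addr0 => [|c /andP[le_cm ne_c]].
  have e := mdeg_mnm_sub le_am; rewrite mdeg_tmon dm in e.
  by congr (_ * _); rewrite -(tmon_mdeg (mnm_sub m _)); congr (fcoef g (tmon _)); lia.
have e := etrans (mdeg_mnm_sub le_cm) dm.
have [lt_c|le_c] := ltnP (mdeg (bmnm c)) a; first by rewrite fa ?mul0r.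
rewrite gb ?mulr0 //.
have : mdeg (bmnm c) != a.
  apply: contra ne_c => /eqP ec; apply/eqP/val_inj => /=.
  by rewrite -(tmon_mdeg (bmnm c)) ec.
by lia.
Qed.

Lemma fps_ord_eq d f : fps_ge d f -> fcoef f (tmon d) != 0 -> fps_ord f = d.
Proof.
move=> fd nz; rewrite /fps_ord.
set A := (X in xget _ X).
have Ad : A d.
  split; first by exists (tmon d); rewrite ?mdeg_tmon.
  by move=> m nzm; rewrite leqNgt; apply: contra nzm => /fd ->.
have [[m nzm <-] min] := @xgetI _ 0%N A _ Ad.
apply/eqP; rewrite eqn_leq; have [_ /(_ _ nzm) ->] := Ad.
by rewrite -[X in (_ <= X)%N](mdeg_tmon d) min.
Qed.

Lemma fps_ord_lead f : f != 0 ->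
  fps_ge (fps_ord f) f /\ fcoef f (tmon (fps_ord f)) != 0.
Proof.
move=> f0; have ex : exists d, fcoef f (tmon d) != 0.
  apply: contrapT => no; case/eqP: f0; apply: fpsP => m /=.
  by apply/eqP/negPn/negP => nz; apply: no; exists (mdeg m); rewrite tmon_mdeg.
pose d := ex_minn ex; have : fcoef f (tmon d) != 0 /\ fps_ge d f.
  rewrite /d; case: ex_minnP => e nz min; split=> // m lt_m.
  apply/eqP/negPn/negP => nzm.
  by have := min (mdeg m); rewrite tmon_mdeg leqNgt lt_m => /(_ nzm).
by case=> nz ge; rewrite (fps_ord_eq ge nz).
Qed.

Lemma fps_ordM f g : f != 0 -> g != 0 -> fps_ord (f * g) = (fps_ord f + fps_ord g)%N.
Proof.
move=> /fps_ord_lead[fa fnz] /fps_ord_lead[gb gnz].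
apply: fps_ord_eq; first exact: fps_ge_mul.
by rewrite fcoef_mul_low // mulf_neq0.
Qed.

Lemma fcoef_const0 (c : k) : fcoef (c%:A : fps 1 k) (tmon 0) = c.
Proof.
have e : tmon 0 = mnm0 by apply/eqP; rewrite -mdeg_eq0 mdeg_tmon.
by rewrite e /= eqxx mulr1.
Qed.

Lemma fps_ord0 f : fcoef f (tmon 0) != 0 -> fps_ord f = 0%N.
Proof. exact: fps_ord_eq. Qed.

Lemma fps_ord1 : fps_ord (1 : fps 1 k) = 0%N.
Proof.
by apply: fps_ord0; rewrite -[1]scale1r fcoef_const0 oner_neq0.
Qed.

Definition tpow (d : nat) : fps 1 k := Fps (fun m => if m == tmon d then 1 else 0).

Lemma tpow_ge d : fps_ge d (tpow d).
Proof.
by move=> m lt_m /=; case: eqP => // e; rewrite e mdeg_tmon ltnn in lt_m.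
Qed.

Lemma fps_ord_tpow d : fps_ord (tpow d) = d.
Proof. by apply: fps_ord_eq (@tpow_ge d) _; rewrite /= eqxx oner_eq0. Qed.

Lemma tpow_neq0 d : tpow d != 0.
Proof.
by apply/eqP => /(congr1 (fun f => fcoef f (tmon d))) /= /eqP; rewrite eqxx oner_eq0.
Qed.

(** This is where a single variable matters: a series of order at least [d] is
    divisible by [t ^ d]. *)
Lemma fps_ge_dvd d f : fps_ge d f -> exists g, f = tpow d * g.
Proof.
move=> fd; pose g : fps 1 k := Fps (fun m => fcoef f (mnm_add m (tmon d))).
exists g; apply: fpsP => m.
have [lt_m|le_m] := ltnP (mdeg m) d.
  rewrite fd // (_ : fcoef (_ * g) m = 0) // (@fps_ge_mul d 0) ?addn0 //.
  exact: tpow_ge.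
have lt_d : (mdeg (tmon d) < (mdeg m).+1)%N by rewrite mdeg_tmon.
rewrite /= (bigD1 (BMultinom lt_d)) ?lem_tmon //= eqxx mul1r submK ?lem_tmon //.
rewrite big1 ?addr0 // => c /andP[_ ne_c]; case: eqP => [e|]; last by rewrite mul0r.
by case/eqP: ne_c; apply: val_inj.
Qed.

(** The geometric series: the coefficient of degree [d] of [1 / (1 - z)] is
    that of the finite sum [1 + z + ... + z ^ d]. *)
Lemma fps_geometric (z : fps 1 k) : fps_ge 1 z -> exists h, (1 - z) * h = 1.
Proof.
move=> z1; have zX j : fps_ge j (z ^+ j).
  by elim: j => [|j IH] //; rewrite exprS -addn1 addnC; apply: fps_ge_mul.
pose p d := \sum_(j < d.+1) z ^+ j.
have pE d m : (mdeg m <= d)%N -> fcoef (p d) m = fcoef (p (mdeg m)) m.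
  elim: d => [|d IH]; first by rewrite leqn0 => /eqP ->.
  rewrite leq_eqVlt => /orP[/eqP ->//|lt_m].
  by rewrite /p big_ord_recr -/(p d) /= IH // zX ?addr0.
pose h : fps 1 k := Fps (fun m => fcoef (p (mdeg m)) m); exists h.
apply: fpsP => m.
transitivity (fcoef ((1 - z) * p (mdeg m)) m).
  apply: eq_bigr => a le_am; congr (_ * _); rewrite /h /= [RHS]pE //.
  by have := mdeg_mnm_sub le_am; lia.
rewrite /p -opprB mulNr -subrX1 opprB.
have -> : fcoef (1 - z ^+ (mdeg m).+1) m =
  fcoef (1 : fps 1 k) m - fcoef (z ^+ (mdeg m).+1) m by [].
by rewrite zX ?subr0.
Qed.

Lemma fps_unit0 f : fcoef f (tmon 0) != 0 -> exists h, f * h = 1.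
Proof.
set c := fcoef f _ => c0; have [|h e] := @fps_geometric (1 - c^-1 *: f).
  move=> m; rewrite ltnS leqn0 => /eqP m0.
  have m00 : m = mnm0 by apply/eqP; rewrite -mdeg_eq0 m0.
  have fm : fcoef f m = c by rewrite -(tmon_mdeg m) m0.
  by rewrite /= fm m00 eqxx mulVf ?subrr.
by exists (c^-1 *: h); rewrite -scalerAr scalerAl -{}e subKr.
Qed.

End PowerSeriesOrder.

(** * The valuation of the field of Laurent series *)

Section LaurentValuation.
Variable k : fieldType.
Local Notation L := (laurent k).
Local Notation tofrac := (@FracField.tofrac (fps 1 k)).
Local Notation val := (@laurent_val k).
Implicit Types (x y : L) (f g : fps 1 k).

Lemma laurent_fraction x : x = tofrac \n_(repr x) / tofrac \d_(repr x).
Proof.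
have d0 : tofrac \d_(repr x) != 0 by rewrite tofrac_eq0 denom_ratioP.
apply: (mulIf d0); rewrite divfK //.
rewrite -[x in LHS]reprK; unlock FracField.tofrac.
rewrite -[LHS]FracField.pi_mul; apply/eqP; rewrite FracField.equivf_def.
by rewrite !numden_Ratio ?mulr1 ?oner_neq0 ?denom_ratioP // reprK mulrC.
Qed.

Lemma laurent_val_div f g : f != 0 -> g != 0 ->
  val (tofrac f / tofrac g) = ((fps_ord f)%:Z - (fps_ord g)%:Z)%:E.
Proof.
move=> f0 g0; set x := _ / _.
have F0 h : h != 0 -> tofrac h != 0 by rewrite tofrac_eq0.
have x0 : x != 0 by rewrite mulf_neq0 ?invr_eq0 ?F0.
rewrite /laurent_val (negPf x0); congr (_%:E).
have d0 : \d_(repr x) != 0 by exact: denom_ratioP.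
have n0 : \n_(repr x) != 0.
  by apply: contra x0 => /eqP e; rewrite [x]laurent_fraction e tofrac0 mul0r.
have e : \n_(repr x) * g = f * \d_(repr x).
  apply/eqP; rewrite -tofrac_eq !tofracM.
  have /eqP := laurent_fraction x.
  by rewrite eq_sym /x eqr_div ?F0.
have := congr1 (@fps_ord k 1) e; rewrite !fps_ordM //; lia.
Qed.

Lemma laurent_val_tofrac f : f != 0 -> val (tofrac f) = (fps_ord f)%:Z%:E.
Proof.
move=> f0; rewrite -[tofrac f]divr1 -tofrac1 laurent_val_div ?oner_neq0 //.
by rewrite fps_ord1 subr0.
Qed.

Lemma laurent_val0 : val 0 = +oo%E.
Proof. by rewrite /laurent_val eqxx. Qed.

Lemma laurent_val_fin x : x != 0 -> exists n : int, val x = n%:E.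
Proof. by move=> x0; rewrite /laurent_val (negPf x0); eexists. Qed.

Lemma laurent_numdenP x : x != 0 ->
  exists f g, [/\ f != 0, g != 0 & x = tofrac f / tofrac g].
Proof.
move=> x0; exists \n_(repr x), \d_(repr x); rewrite denom_ratioP -laurent_fraction.
split=> //; apply: contra x0 => /eqP e.
by rewrite [x]laurent_fraction e tofrac0 mul0r.
Qed.

Lemma laurent_valM x y : val (x * y) = (val x + val y)%E.
Proof.
case: (eqVneq x 0) => [->|x0].
  rewrite mul0r laurent_val0.
  case: (eqVneq y 0) => [->|y0]; first by rewrite laurent_val0.
  by have [n ->] := laurent_val_fin y0.
case: (eqVneq y 0) => [->|y0].
  by rewrite mulr0 laurent_val0; have [n ->] := laurent_val_fin x0.
have [f [g [f0 g0 ->]]] := laurent_numdenP x0.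
have [f' [g' [f'0 g'0 ->]]] := laurent_numdenP y0.
rewrite mulf_div -!tofracM !laurent_val_div ?mulf_neq0 // -EFinD; congr (_%:E).
rewrite !fps_ordM //; lia.
Qed.

(** Cancelling the power of [t] in the denominator leaves a series with nonzero
    constant term, which is invertible. *)
Lemma laurent_val_ge0 x : (0 <= val x)%E <-> range tofrac x.
Proof.
case: (eqVneq x 0) => [->|x0].
  by rewrite laurent_val0; split=> // _; exists 0; rewrite ?tofrac0.
have [f [g [f0 g0 ex]]] := laurent_numdenP x0; split.
  rewrite ex laurent_val_div // lee_fin subr_ge0 lez_nat => le_gf.
  have [gO gnz] := fps_ord_lead g0; have [g' eg] := fps_ge_dvd gO.
  have [f' ef] : exists f', f = tpow k (fps_ord g) * f'.
    have [fO _] := fps_ord_lead f0; apply: fps_ge_dvd => m lt_m; apply: fO.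
    exact: leq_trans le_gf.
  have [h eh] : exists h, g' * h = 1.
    apply: fps_unit0; apply: contra gnz => /eqP e0; rewrite {1}eg.
    rewrite -[X in tmon X]addn0 fcoef_mul_low ?e0 ?mulr0 //; exact: tpow_ge.
  exists (f' * h) => //; apply: (@mulIf _ (tofrac g)); first by rewrite tofrac_eq0.
  rewrite divfK ?tofrac_eq0 // -tofracM [in RHS]ef {1}eg; congr (tofrac _).
  by rewrite mulrCA -mulrA (mulrC h) eh mulr1.
case=> h _ eh; rewrite -eh; have h0 : h != 0.
  by apply: contra x0 => /eqP e; rewrite -eh e tofrac0.
by rewrite laurent_val_tofrac // lee_fin.
Qed.

Lemma laurent_val_const (c : k) : c != 0 -> val (tofrac (c%:A)) = 0%E.
Proof.
move=> c0; have e := fcoef_const0 c.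
have nz : (c%:A : fps 1 k) != 0.
  by apply/eqP => e0; move: c0; rewrite -e e0 eqxx.
by rewrite laurent_val_tofrac // fps_ord0 ?e.
Qed.

Lemma laurent_uniformizer : exists t, val t = 1%:E.
Proof.
by exists (tofrac (tpow k 1)); rewrite laurent_val_tofrac ?tpow_neq0 // fps_ord_tpow.
Qed.

Lemma laurent_residue x : (0 <= val x)%E ->
  exists c : k, (1%:E <= val (x - tofrac c%:A))%E.
Proof.
case/laurent_val_ge0 => f _ <-; exists (fcoef f (tmon 0)).
rewrite -tofracB; set g := f - _; case: (eqVneq g 0) => [->|g0].
  by rewrite tofrac0 laurent_val0 leey.
rewrite laurent_val_tofrac // lee_fin.
have [_] := fps_ord_lead g0; case: (fps_ord g) => // /eqP[].
have -> : fcoef g (tmon 0) =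
  fcoef f (tmon 0) - fcoef ((fcoef f (tmon 0))%:A : fps 1 k) (tmon 0) by [].
by rewrite fcoef_const0 subrr.
Qed.

Lemma laurent_val_neq0 x (n : int) : val x = n%:E -> x != 0.
Proof. by move=> vx; apply/eqP => x0; rewrite x0 laurent_val0 in vx. Qed.

Lemma laurent_valV x (n : int) : val x = n%:E -> val x^-1 = (- n)%:E.
Proof.
move=> vx; have x0 := laurent_val_neq0 vx.
have [m vm] : exists m : int, val x^-1 = m%:E.
  by apply: laurent_val_fin; rewrite invr_eq0.
have := laurent_valM x x^-1; rewrite divff // vx vm -tofrac1.
rewrite laurent_val_tofrac ?oner_neq0 //.
by rewrite fps_ord1 -EFinD => -[] e; congr (_%:E); lia.
Qed.

Lemma laurent_val_surj (n : int) : exists x, val x = n%:E.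
Proof.
have [t vt] := laurent_uniformizer; have t0 := laurent_val_neq0 vt.
have vX m : val (t ^+ m) = m%:Z%:E.
  elim: m => [|m IH]; last by rewrite exprS laurent_valM vt IH -EFinD.
  by rewrite expr0 -tofrac1 laurent_val_tofrac ?oner_neq0 // fps_ord1.
case: n => n; first by exists (t ^+ n).
by exists (t ^+ n.+1)^-1; rewrite (laurent_valV (vX _)).
Qed.

Lemma laurent_val_ge_div x y (m n : int) : val y = n%:E ->
  (m%:E <= val (x / y))%E = ((m + n)%:E <= val x)%E.
Proof.
move=> vy; have y0 := laurent_val_neq0 vy.
have -> : val x = (val (x / y) + n%:E)%E by rewrite -vy -laurent_valM divfK.
have [->|xy0] := eqVneq (x / y) 0; first by rewrite laurent_val0 !leey.
by have [l ->] := laurent_val_fin xy0; rewrite -EFinD !lee_fin lerD2r.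
Qed.

(** Dividing by an element of value [n] reduces this to the stability of
    [k[[t]]] under addition. *)
Lemma laurent_valD (n : int) x y :
  (n%:E <= val x)%E -> (n%:E <= val y)%E -> (n%:E <= val (x + y))%E.
Proof.
have [z vz] := laurent_val_surj n.
rewrite -[n]add0r -!(laurent_val_ge_div _ 0 vz) mulrDl.
move=> /laurent_val_ge0[f _ <-] /laurent_val_ge0[g _ <-].
by apply/laurent_val_ge0; exists (f + g); rewrite ?tofracD.
Qed.

Lemma laurent_residue_div x y (n : int) : (n%:E <= val x)%E -> val y = n%:E ->
  exists c : k, ((n + 1)%:E <= val (x - tofrac c%:A * y))%E.
Proof.
move=> nx vy; have [|c hc] := @laurent_residue (x / y).
  by rewrite (laurent_val_ge_div _ 0 vy) add0r.
exists c; rewrite addrC -(laurent_val_ge_div _ 1 vy) mulrBl mulfK //.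
exact: laurent_val_neq0 vy.
Qed.

End LaurentValuation.

(** * Primes of a reduced ring and powers of an ideal *)

Section Ideals.
Variable A : comNzRingType.
Implicit Types (J P Q S : set A) (x y : A).

Lemma idealrP J : idealr_closed [in J] <->
  [/\ J 0, ~ J 1 & forall a u w, J u -> J w -> J (a * u + w)].
Proof.
have inJ x : (x \in [in J]) = `[< J x >] by apply/idP/asboolP; rewrite in_setE.
split=> [[J0 J1 JD]|[J0 J1 JD]]; split.
- by move: J0; rewrite inJ => /asboolP.
- by move: J1; rewrite inJ => /asboolP.
- move=> a u w Ju Jw; have := JD a u w; rewrite !inJ => h.
  by apply/asboolP/h; apply/asboolP.
- by rewrite inJ; apply/asboolP.
- by rewrite inJ; apply/asboolP.
- by move=> a u w; rewrite !inJ => /asboolP Ju /asboolP Jw; apply/asboolP/JD.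
Qed.

Lemma prime_idealP P : prime_ideal P <->
  idealr_closed [in P] /\ forall x y, P (x * y) -> P x \/ P y.
Proof.
have inP x : (x \in [in P]) = `[< P x >] by apply/idP/asboolP; rewrite in_setE.
split=> -[iP pP]; split=> //.
  move=> x y Pxy; have := pP x y; rewrite !inP => /(_ (asboolT Pxy)).
  by case/orP => /asboolP; [left|right].
move=> x y; rewrite !inP => /asboolP/pP h; apply/orP.
by case: h => h; [left|right]; apply/asboolP.
Qed.

Lemma ideal_powM J n a x : (forall b y, J y -> J (b * y)) ->
  ideal_pow J n x -> ideal_pow J n (a * x).
Proof.
move=> JM; case: n => [//|n] [s sJ ->].
exists [seq (a * p.1, p.2) | p <- s].
  by move=> _ /mapP[p /sJ[p1 p2] ->]; split=> //; apply: JM.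
by rewrite big_map mulr_sumr; apply: eq_bigr => p _; rewrite mulrA.
Qed.

Lemma ideal_powD J n x y :
  ideal_pow J n x -> ideal_pow J n y -> ideal_pow J n (x + y).
Proof.
case: n => [//|n] [s sJ ->] [t tJ ->]; exists (s ++ t); last by rewrite big_cat.
by move=> p; rewrite mem_cat => /orP[/sJ|/tJ].
Qed.

Lemma ideal_powX J n x : J x -> ideal_pow J n (x ^+ n).
Proof.
move=> Jx; elim: n => [//|n IH]; exists [:: (x, x ^+ n)].
  by move=> p; rewrite inE => /eqP ->.
by rewrite big_seq1 exprS.
Qed.

(** The partial sums of the geometric series converge by completeness, and
    uniqueness of limits identifies [(1 - x) * y] with [1]. *)
Lemma complete_geometric J x : idealr_closed [in J] -> adically_complete J ->
  J x -> exists y, (1 - x) * y = 1.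
Proof.
move=> /idealrP[J0 _ JD] compl Jx.
have JM b y : J y -> J (b * y) by move=> Jy; rewrite -[_ * _]addr0; apply: JD.
pose u n := \sum_(j < n) x ^+ j.
have [n|y [lim _]] := compl u.
  by rewrite /u big_ord_recr /= addrAC subrr add0r; apply: ideal_powX.
exists y; apply/eqP; rewrite -subr_eq0; apply/eqP.
have pow0 n : ideal_pow J n 0.
  by case: n => [//|n]; exists [::]; rewrite ?big_nil.
have [n|z [_ uniq]] := compl (fun=> 0); first by rewrite subrr.
have <- : z = 0 by apply: uniq => n; rewrite subrr.
apply/esym/uniq => n; rewrite subr0.
have -> : (1 - x) * y - 1 = (1 - x) * (y - u n) + -1 * x ^+ n.
  rewrite mulrBr; have -> : (1 - x) * u n = 1 - x ^+ n.
    by rewrite -[1 - x]opprB mulNr -subrX1 opprB.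
  by ring.
by apply: ideal_powD; apply: ideal_powM => //; apply: ideal_powX.
Qed.

(** The complement of a multiplicative set that avoids [0] and is maximal as
    such is a minimal prime; in a reduced ring, the powers of a nonzero element
    extend to such a set. *)
Lemma reduced_minimal_prime x : (forall (y : A) n, y ^+ n = 0 -> y = 0) ->
  x <> 0 -> exists P, minimal_prime P /\ ~ P x.
Proof.
move=> red x0.
(* The empty set is allowed, so that the union of an empty chain qualifies. *)
pose mset S := [/\ forall y, S y -> S 1 /\ S x,
  forall y z, S y -> S z -> S (y * z) & ~ S 0].
have [F chF totF|S [Sm maxS]] := @Zorn_bigcup A mset.
  split.
  - move=> y [S FS Sy]; have [S1 _ _] := chF _ FS.
    by have [? ?] := S1 y Sy; split; exists S.
  - move=> y z [S FS Sy] [S' FS' S'z].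
    have [SS'|S'S] := totF S S' FS FS'.
      by have [_ M _] := chF _ FS'; exists S' => //; apply: M => //; apply: SS'.
    by have [_ M _] := chF _ FS; exists S => //; apply: M => //; apply: S'S.
  - by move=> [S /chF[_ _ S0]].
have [S1x SM S0] := Sm.
have ext T : S `<=` T -> mset T -> T = S.
  move=> ST Tm; apply/seteqP; split=> //; apply: contrapT => nTS.
  by apply: (maxS T).
have [S1 Sx] : S 1 /\ S x.
  have [[y Sy]|no] := pselect (exists y, S y); first exact: S1x Sy.
  have e : [set x ^+ n | n in setT] = S.
    apply: ext; first by move=> y Sy; case: no; exists y.
    split.
    - by move=> y _; split; [exists 0%N; rewrite ?expr0 | exists 1%N; rewrite ?expr1].
    - by move=> _ _ [n _ <-] [m _ <-]; exists (n + m)%N; rewrite ?exprD.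
    - by move=> [n _ /red].
  by rewrite -e; split; [exists 0%N; rewrite ?expr0 | exists 1%N; rewrite ?expr1].
have SX n y : S y -> S (y ^+ n).
  by move=> Sy; elim: n => [|n IH]; rewrite ?expr0 ?exprS //; apply: SM.
have notS y : ~ S y -> exists s n, S s /\ s * y ^+ n = 0.
  move=> nSy; apply: contrapT => no; apply: nSy.
  pose T := [set s | exists t n, S t /\ s = t * y ^+ n].
  have <- : T = S.
    apply: ext; first by move=> s Ss; exists s, 0%N; rewrite expr0 mulr1.
    have ST s : S s -> T s by move=> Ss; exists s, 0%N; rewrite expr0 mulr1.
    split.
    - by move=> z _; split; apply: ST.
    - move=> _ _ [s [n [Ss ->]]] [t [m [St ->]]]; exists (s * t), (n + m)%N.
      by split; [exact: SM | rewrite exprD mulrACA].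
    - by move=> [s [n [Ss e]]]; apply: no; exists s, n.
  by exists 1, 1%N; rewrite mul1r.
have zeroS s y n : S s -> s * y ^+ n = 0 -> ~ S y.
  by move=> Ss e Sy; apply: S0; rewrite -e; apply: SM => //; apply: SX.
have primeS : prime_ideal (~` S).
  apply/prime_idealP; split.
    apply/idealrP; split=> // a u w /notS[s [n [Ss e]]] /notS[t [m [St f]]].
    apply: (zeroS (s * t) _ (n + m)%N); first exact: SM.
    rewrite exprDn mulr_sumr big1 // => i _; rewrite mulrnAr.
    have [le_in|lt_ni] := leqP n (n + m - i).
      have -> : s * t * ((a * u) ^+ (n + m - i) * w ^+ i) =
        (s * u ^+ n) * (t * a ^+ (n + m - i) * u ^+ (n + m - i - n) * w ^+ i).
        have -> : (a * u) ^+ (n + m - i) =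
            a ^+ (n + m - i) * (u ^+ n * u ^+ (n + m - i - n)).
          by rewrite exprMn -exprD subnKC.
        by ring.
      by rewrite e mul0r mul0rn.
    have le_mi : (m <= i)%N by lia.
    have -> : s * t * ((a * u) ^+ (n + m - i) * w ^+ i) =
        (t * w ^+ m) * (s * (a * u) ^+ (n + m - i) * w ^+ (i - m)).
      have -> : w ^+ i = w ^+ m * w ^+ (i - m) by rewrite -exprD subnKC.
      by ring.
    by rewrite f mul0r mul0rn.
  move=> y z nSyz; apply: contrapT => /not_orP[/contrapT Sy /contrapT Sz].
  exact/nSyz/SM.
exists (~` S); split; last by move=> /(_ Sx).
split=> // Q /prime_idealP[/idealrP[Q0 Q1 QD] Qp] QS.
rewrite -[Q]setCK; congr (~` _); apply: ext.
  by move=> y Sy Qy; apply: QS Qy Sy.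
split=> [y _|y z nQy nQz /Qp[]//|//]; split=> // Qx.
by have := QS _ Qx; apply.
Qed.

End Ideals.

(** * Subrings of a product of valued fields *)

Section ValuedAlgebra.
Variables (k : closedFieldType) (O : comAlgType k).
Variables (K : comUnitRingType) (iota : {rmorphism O -> K}).
Variables (r : nat) (v : 'I_r -> K -> \bar int).

Local Notation R := (range iota).
Local Notation sc c := (iota (c%:A)).
Local Notation point := {ffun 'I_r -> int}.
Local Notation fil X a := (filtration v X a).
Local Notation full a := (filtration v setT a).
Local Notation e_ := (@std_basis r).

Implicit Types (a b : point) (X Y : set K).

(** Axioms for [K] to be a finite product of discretely valued fields with
    residue field [k], [v i] being the valuation of the [i]-th factor; it takes
    the value [+oo] on every element whose [i]-th component is zero. *)
Record product_valuation : Prop := ProductValuation {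
  pvM : forall i x y, v i (x * y) = (v i x + v i y)%E;
  pvD : forall i (n : int) x y,
    (n%:E <= v i x)%E -> (n%:E <= v i y)%E -> (n%:E <= v i (x + y))%E;
  pv0 : forall i, v i 0 = +oo%E;
  pv_fin : forall i x, v i x = +oo%E \/ exists n : int, v i x = n%:E;
  pv_const : forall i c, c != 0 -> v i (sc c) = 0%E;
  pv_residue : forall i x y (n : int), (n%:E <= v i x)%E -> v i y = n%:E ->
    exists c, ((n + 1)%:E <= v i (x - sc c * y))%E;
  pv_sep : forall x, (forall i, v i x = +oo%E) -> x = 0;
  pv_component : forall i (n : int), exists x,
    v i x = n%:E /\ forall j, j != i -> v j x = +oo%E;
  pv_idem : exists e : 'I_r -> K, \sum_i e i = 1 /\
    forall i, v i (e i) = 0%E /\ forall j, j != i -> v j (e i) = +oo%E }.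

Hypothesis pv : product_valuation.

Lemma val_ge_trans i (m n : int) x :
  m <= n -> (n%:E <= v i x)%E -> (m%:E <= v i x)%E.
Proof. by move=> le_mn; apply: le_trans; rewrite lee_fin. Qed.

Lemma val_geM i (m n : int) x y :
  (m%:E <= v i x)%E -> (n%:E <= v i y)%E -> ((m + n)%:E <= v i (x * y))%E.
Proof. by move=> mx ny; rewrite (pvM pv) EFinD leeD. Qed.

Lemma val_ge_scale i (n : int) c x : (n%:E <= v i x)%E -> (n%:E <= v i (sc c * x))%E.
Proof.
move=> nx; case: (eqVneq c 0) => [->|c0].
  by rewrite scale0r rmorph0 mul0r (pv0 pv) leey.
by rewrite (pvM pv) (pv_const pv) // add0e.
Qed.

Lemma val_eq_geF i (n : int) x : v i x = n%:E -> ((n + 1)%:E <= v i x)%E = false.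
Proof. by move=> ->; rewrite lee_fin; apply/negbTE; lia. Qed.

Lemma val_ge_succ i (n : int) x :
  (n%:E <= v i x)%E -> v i x <> n%:E -> ((n + 1)%:E <= v i x)%E.
Proof.
case: (pv_fin pv i x) => [->|[m ->]]; first by rewrite !leey.
rewrite !lee_fin => le_nm ne; have : n != m by apply/eqP => e; case: ne; rewrite e.
by lia.
Qed.

Lemma scB c d : sc (c - d) = sc c - sc d.
Proof. by rewrite scalerBl rmorphB. Qed.

Lemma scM c d : sc (c * d) = sc c * sc d.
Proof. by rewrite -rmorphM mulr_algl scalerA. Qed.

Lemma sc1 : sc 1 = 1. Proof. by rewrite scale1r rmorph1. Qed.

Lemma scN1 x : - x = sc (-1) * x.
Proof. by rewrite scaleN1r rmorphN1 mulN1r. Qed.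

Lemma pointD (a b : point) i : (a + b) i = a i + b i. Proof. by rewrite ffunE. Qed.
Lemma pointN (a : point) i : (- a) i = - a i. Proof. by rewrite ffunE. Qed.
Lemma point0 i : (0 : point) i = 0. Proof. by rewrite ffunE. Qed.
Definition pointE := (pointD, pointN, point0).

Lemma std_basis_eq i : e_ i i = 1.
Proof. by rewrite ffunE eqxx. Qed.

Lemma std_basis_neq i j : j != i -> e_ i j = 0.
Proof. by rewrite ffunE => /negPf ->. Qed.

Lemma std_basis_ge0 i j : 0 <= e_ i j.
Proof. by rewrite ffunE ler0n. Qed.

(** * Dimensions of quotients *)

Definition subspace (X : set K) :=
  [/\ X 0, forall x y, X x -> X y -> X (x + y) & forall c x, X x -> X (sc c * x)].

Lemma subspaceB X x y : subspace X -> X x -> X y -> X (x - y).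
Proof. by case=> _ XD XZ Xx Xy; apply: XD => //; rewrite scN1; apply: XZ. Qed.

Lemma subspace_sum X n (c : 'I_n -> k) (b : 'I_n -> K) :
  subspace X -> (forall j, X (b j)) -> X (\sum_(j < n) sc (c j) * b j).
Proof.
by case=> X0 XD XZ Xb; apply: (big_ind X) => // j _; apply: XZ.
Qed.

Lemma submodule_subspace X : submodule iota X -> subspace X.
Proof. by case=> X0 XD XZ; split=> // c x; apply: XZ. Qed.

Lemma subspace_fil X a : subspace X -> subspace (fil X a).
Proof.
case=> X0 XD XZ; split.
- by split=> // i; rewrite (pv0 pv) leey.
- by move=> x y [Xx ax] [Xy ay]; split; [exact: XD | move=> i; exact: (pvD pv)].
- by move=> c x [Xx ax]; split; [exact: XZ | move=> i; exact: val_ge_scale].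
Qed.

Definition spans (Y X : set K) n (b : 'I_n -> K) :=
  forall x, Y x -> exists c : 'I_n -> k, X (x - \sum_(j < n) sc (c j) * b j).

Definition independent (X : set K) n (b : 'I_n -> K) :=
  forall c : 'I_n -> k, X (\sum_(j < n) sc (c j) * b j) -> forall j, c j = 0.

Lemma quotient_basisP Y X n (b : 'I_n -> K) : subspace Y -> subspace X ->
  quotient_basis iota Y X b <->
  [/\ forall j, Y (b j), spans Y X b & independent X b].
Proof.
move=> sY sX; split=> [[Yb ex]|[Yb sp ind]].
  split=> // [x /ex[c [Xc _]]|c Xc j]; first by exists c.
  have Ys : Y (\sum_(j < n) sc (c j) * b j) by exact: subspace_sum.
  have [d [_ uniq]] := ex _ Ys.
  have e0 : d = 0.
    apply: uniq; rewrite [X in _ - X]big1 ?subr0 // => l _.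
    by rewrite ffunE scale0r rmorph0 mul0r.
  have := uniq [ffun j => c j]; rewrite e0 => /(_ _) e1.
  have -> : c j = [ffun j => c j] j by rewrite ffunE.
  rewrite -e1 ?ffunE // [X in _ - X](eq_bigr (fun j => sc (c j) * b j)).
    by rewrite subrr; case: sX.
  by move=> l _; rewrite ffunE.
split=> // x Yx; have [c Xc] := sp x Yx; exists [ffun j => c j]; split.
  by rewrite (eq_bigr (fun j => sc (c j) * b j)) // => l _; rewrite ffunE.
move=> d Xd; apply/ffunP => j; rewrite ffunE.
apply/eqP; rewrite -subr_eq0; apply/eqP.
apply: (ind (fun j => c j - d j)).
have -> : \sum_(j < n) sc (c j - d j) * b j =
  (x - \sum_(j < n) sc (d j) * b j) - (x - \sum_(j < n) sc (c j) * b j).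
  rewrite opprB addrC addrA subrK -sumrB; apply: eq_bigr => i _.
  by rewrite scB mulrBl.
exact: subspaceB.
Qed.

(** Write the [b j] as combinations of the [b' l] modulo [X]: with more rows than
    columns, the matrix of coefficients has a nonzero row kernel, which is a
    linear relation between the [b j]. *)
Lemma independent_le_spans Y X n m (b : 'I_n -> K) (b' : 'I_m -> K) : subspace X ->
  (forall j, Y (b j)) -> independent X b -> spans Y X b' -> (n <= m)%N.
Proof.
move=> sX Yb ind sp; rewrite leqNgt; apply/negP => lt_mn.
have /choice[A XA] : forall j, exists c : 'I_m -> k,
  X (b j - \sum_(l < m) sc (c l) * b' l) by move=> j; apply: sp.
pose M : 'M_(n, m) := \matrix_(j, l) A j l.
have : kermx M != 0.
  rewrite -mxrank_eq0 mxrank_ker subn_eq0 -ltnNge.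
  exact: leq_ltn_trans (rank_leq_col M) lt_mn.
case/rowV0Pn => u /sub_kermxP uM; case/negP; apply/eqP/rowP => j.
rewrite mxE; apply: (ind (u 0)).
have -> : \sum_(j < n) sc (u 0 j) * b j =
   \sum_(j < n) sc (u 0 j) * (b j - \sum_(l < m) sc (A j l) * b' l).
  under [RHS]eq_bigr do rewrite mulrBr; rewrite sumrB.
  rewrite [X in _ - X](_ : _ = 0) ?subr0 //.
  under eq_bigr do rewrite mulr_sumr; rewrite exchange_big big1 //= => l _.
  under eq_bigr do rewrite mulrA -scM; rewrite -mulr_suml -rmorph_sum -scaler_suml.
  have := congr1 (fun N : 'rV_m => N 0 l) uM; rewrite !mxE => e.
  rewrite (_ : \sum_(i < n) _ = 0) ?scale0r ?rmorph0 ?mul0r // -[RHS]e.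
  by apply: eq_bigr => i _; rewrite mxE.
exact: subspace_sum.
Qed.

Lemma quotient_basis_size Y X n m (b : 'I_n -> K) (b' : 'I_m -> K) :
  subspace Y -> subspace X ->
  quotient_basis iota Y X b -> quotient_basis iota Y X b' -> n = m.
Proof.
move=> sY sX /(quotient_basisP _ sY sX)[Yb sp ind].
move=> /(quotient_basisP _ sY sX)[Yb' sp' ind'].
apply/eqP; rewrite eqn_leq.
rewrite (independent_le_spans sX Yb ind sp').
exact: independent_le_spans sX Yb' ind' sp.
Qed.

Lemma nat_or_oo_unique (A : set nat) n :
  A n -> (forall m, A m -> m = n) -> nat_or_oo A = n%:Z%:E.
Proof.
move=> An uniq; rewrite /nat_or_oo; case: asboolP => [_|]; last by case; exists n.
by rewrite (uniq _ (xgetI _ An)).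
Qed.

Lemma quotient_dimE Y X n (b : 'I_n -> K) : subspace Y -> subspace X ->
  quotient_basis iota Y X b -> quotient_dim iota Y X = n%:Z%:E.
Proof.
move=> sY sX qb; apply: nat_or_oo_unique; first by exists b.
by move=> m [b' qb']; apply: quotient_basis_size qb' qb.
Qed.

(** * Jumps along lattice paths *)

(** Whether the graded piece [X(a) / X(a + e_i)] is nonzero. *)
Definition jump (X : set K) (a : point) i : bool :=
  `[< exists2 h, fil X a h & v i h = (a i)%:E >].

(** A lattice path is the sequence of the directions of its unit steps. *)
Definition disp (s : seq 'I_r) : point := \sum_(i <- s) e_ i.

Fixpoint jumps X (a : point) s : nat :=
  if s is i :: s' then (jump X a i + jumps X (a + e_ i)%R s')%N else 0%N.

Lemma disp_cons i s : disp (i :: s) = e_ i + disp s.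
Proof. by rewrite /disp big_cons. Qed.

Lemma disp_cat s t : disp (s ++ t) = disp s + disp t.
Proof. by rewrite /disp big_cat. Qed.

Lemma disp_nil : disp [::] = 0.
Proof. by rewrite /disp big_nil. Qed.

Lemma disp_ge0 s i : 0 <= disp s i.
Proof.
elim: s => [|j s IH]; first by rewrite disp_nil ffunE.
by rewrite disp_cons ffunE addr_ge0 // std_basis_ge0.
Qed.

Lemma jumps_cat X a s t :
  jumps X a (s ++ t) = (jumps X a s + jumps X (a + disp s)%R t)%N.
Proof.
elim: s a => [|i s IH] a /=; first by rewrite disp_nil addr0.
by rewrite IH disp_cons addrA addnA.
Qed.

Lemma fil_sub X (a b : point) : (forall i, a i <= b i) -> fil X b `<=` fil X a.
Proof. by move=> le_ab x [Xx bx]; split=> // i; apply: val_ge_trans (bx i). Qed.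

Lemma fil_low X a : X `<=` full a -> fil X a = X.
Proof.
move=> Xa; apply/seteqP; split=> x; first by case.
by move=> Xx; split=> //; case: (Xa _ Xx).
Qed.

Lemma fil_subset X Y a : X `<=` Y -> fil X a `<=` fil Y a.
Proof. by move=> XY x [/XY Yx ax]. Qed.

Lemma le_add_std (a : point) i j : a j <= (a + e_ i) j.
Proof. by rewrite ffunE lerDl std_basis_ge0. Qed.

Lemma fil_stepP X (a : point) i x :
  fil X (a + e_ i) x <-> fil X a x /\ ((a i + 1)%:E <= v i x)%E.
Proof.
split=> [f|[[Xx ax] aix]].
  split; first exact: fil_sub (@le_add_std a i) _ f.
  by case: f => _ /(_ i); rewrite ffunE std_basis_eq.
split=> // j; rewrite ffunE.
case: (eqVneq j i) => [->|ne]; first by rewrite std_basis_eq.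
by rewrite std_basis_neq // addr0.
Qed.

Lemma no_jump X a i : ~~ jump X a i -> fil X a `<=` fil X (a + e_ i)%R.
Proof.
move=> /asboolPn nj x ax; apply/fil_stepP; split=> //.
apply: val_ge_succ; first by case: ax.
by move=> e; apply: nj; exists x.
Qed.

(** Elements of value [a i] have proportional leading terms, as the residue field
    is [k]. *)
Lemma jump_step X Y a i h :
  subspace Y -> X `<=` Y -> fil X a h -> v i h = (a i)%:E ->
  forall x, fil Y a x -> exists c, fil Y (a + e_ i)%R (x - sc c * h).
Proof.
move=> sY XY ah eh x ax; have [c hc] := pv_residue pv (ax.2 i) eh.
exists c; apply/fil_stepP; split=> //.
have sf := subspace_fil a sY; apply: subspaceB => //; case: sf => _ _; apply.
exact: fil_subset ah.
Qed.

(** A basis of [Y(a) / X(a)] is obtained by choosing an element of [Y] with the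
    right leading term at each step where [Y] jumps and [X] does not. *)
Lemma basis_jumps X Y a s : subspace X -> subspace Y -> X `<=` Y ->
  fil Y (a + disp s) `<=` X ->
  exists n, exists2 b : 'I_n -> K, quotient_basis iota (fil Y a) (fil X a) b
    & (n + jumps X a s = jumps Y a s)%N.
Proof.
move=> sX sY XY; elim: s a => [|i s IH] a end_XY.
  exists 0%N, (fun _ => 0) => //; apply/quotient_basisP.
  - exact: subspace_fil.
  - exact: subspace_fil.
  split=> [[] // | x Yx | c _ [] //].
  exists (fun _ => 0); rewrite big_ord0 subr0; split; last by case: Yx.
  by apply: end_XY; rewrite disp_nil addr0.
(* A basis for the rest of the path; one more element is needed if [Y] jumps at
   the first step and [X] does not. *)
have [n [b qb en]] : exists n, exists2 b : 'I_n -> K, quotient_basis iota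
    (fil Y (a + e_ i)%R) (fil X (a + e_ i)%R) b
    & (n + jumps X (a + e_ i)%R s = jumps Y (a + e_ i)%R s)%N.
  by apply: IH; rewrite -addrA -disp_cons.
have sX' b' := subspace_fil b' sX; have sY' b' := subspace_fil b' sY.
move/(quotient_basisP _ (sY' _) (sX' _)): qb => [Yb sp ind].
have Yba j : fil Y a (b j) by exact: fil_sub (@le_add_std a i) _ (Yb j).
have [jX|jX] := boolP (jump X a i).
  have [h ah eh] := asboolW jX.
  have jY : jump Y a i by apply/asboolP; exists h => //; exact: fil_subset ah.
  exists n, b; last by rewrite /= jX jY -en; lia.
  apply/quotient_basisP => //; split=> // [x Yx|c Xc].
    have [c0 Yx'] := jump_step sY XY ah eh Yx.
    have [c Xc] := sp _ Yx'; exists c.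
    rewrite -[x](subrK (sc c0 * h)) addrAC; case: (sX' a) => _ XD XZ; apply: XD.
      exact: fil_sub (@le_add_std a i) _ Xc.
    exact: XZ.
  apply: ind; apply/fil_stepP; split=> //.
  by have /fil_stepP[] := subspace_sum c (sY' _) Yb.
have [jY|jY] := boolP (jump Y a i); last first.
  exists n, b; last by rewrite /= (negPf jX) (negPf jY).
  apply/quotient_basisP => //; split=> // [x Yx|c Xc].
    have [c Xc] := sp _ (no_jump jY Yx); exists c.
    exact: fil_sub (@le_add_std a i) _ Xc.
  by apply: ind; apply: no_jump.
have [h ah eh] := asboolW jY.
exists n.+1, (fun j => oapp b h (unlift ord0 j)).
  2: by rewrite /= (negPf jX) jY -en; lia.
have sumE c : \sum_(j < n.+1) sc (c j) * oapp b h (unlift ord0 j) =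
    sc (c ord0) * h + \sum_(j < n) sc (c (lift ord0 j)) * b j.
  rewrite big_ord_recl unlift_none; congr (_ + _).
  by apply: eq_bigr => j _; rewrite liftK.
apply/quotient_basisP => //; split.
- by move=> j; case: unliftP => [l _|_] /=.
- move=> x Yx; have [c0 Yx'] := jump_step sY (@subset_refl _ Y) ah eh Yx.
  have [c Xc] := sp _ Yx'.
  exists (fun j => oapp c c0 (unlift ord0 j)); rewrite sumE unlift_none /=.
  under eq_bigr do rewrite liftK /=.
  rewrite opprD addrA; exact: fil_sub (@le_add_std a i) _ Xc.
- move=> c; rewrite sumE => Xc.
  have sumY := subspace_sum (fun j => c (lift ord0 j)) (sY' _) Yb.
  have c0 : c ord0 = 0.
    apply/eqP/negPn/negP => c0; have /fil_stepP[_ h1] := no_jump jX Xc.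
    have /fil_stepP[_ h2] := sumY.
    have h3 : ((a i + 1)%:E <= v i (sc (c ord0) * h))%E.
      rewrite -[_ * h](addrK (\sum_(j < n) sc (c (lift ord0 j)) * b j)).
      by apply: (pvD pv) => //; rewrite scN1; apply: val_ge_scale.
    by move: h3; rewrite (pvM pv) (pv_const pv) // add0e (val_eq_geF eh).
  move: Xc; rewrite c0 scale0r rmorph0 mul0r add0r => Xc j.
  case: (unliftP ord0 j) => [l ->|->] //.
  by apply: (ind (fun j => c (lift ord0 j))); apply: no_jump.
Qed.

Lemma subspace_setT : subspace setT.
Proof. by []. Qed.

Lemma subspace_full a : subspace (full a).
Proof. exact: subspace_fil subspace_setT. Qed.

Lemma submodule_range : submodule iota R.
Proof.
split; first by exists 0; rewrite ?rmorph0.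
- by move=> _ _ [x _ <-] [y _ <-]; exists (x + y); rewrite ?rmorphD.
- by move=> a _ [x _ <-]; exists (a * x); rewrite ?rmorphM.
Qed.

Lemma subspace_range : subspace R.
Proof. exact: submodule_subspace submodule_range. Qed.

Lemma val_addy i x y : v i y = +oo%E -> v i (x + y) = v i x.
Proof.
move=> vy; have geD z (n : int) : (n%:E <= v i z)%E -> (n%:E <= v i (z + y))%E.
  by move=> nz; apply: (pvD pv); rewrite ?vy ?leey.
have geB z (n : int) : (n%:E <= v i (z + y))%E -> (n%:E <= v i z)%E.
  move=> nz; rewrite -[z](addrK y); apply: (pvD pv) => //.
  by rewrite scN1; apply: val_ge_scale; rewrite vy leey.
case: (pv_fin pv i x) => [vx|[n vx]].
  rewrite vx; case: (pv_fin pv i (x + y)) => [//|[n vn]].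
  by have := val_eq_geF vn; rewrite geD // vx leey.
rewrite vx; apply: contrapT => ne; have /val_ge_succ/(_ ne) : (n%:E <= v i (x + y))%E.
  by apply: geD; rewrite vx.
by move/geB; rewrite (val_eq_geF vx).
Qed.

Lemma val_sumy i (J : finType) (P : pred J) (x : J -> K) :
  (forall j, P j -> v i (x j) = +oo%E) -> v i (\sum_(j | P j) x j) = +oo%E.
Proof.
move=> vx; apply: (big_ind (fun y => v i y = +oo%E)) => //; first exact: pv0 pv i.
by move=> y z vy vz; rewrite val_addy.
Qed.

Lemma val_surj (a : point) : exists x, forall i, v i x = (a i)%:E.
Proof.
have /choice[x xP] : forall i, exists x,
    v i x = (a i)%:E /\ forall j, j != i -> v j x = +oo%E.
  by move=> i; apply: pv_component.
exists (\sum_i x i) => i; rewrite (bigD1 i) //= val_addy; first by case: (xP i).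
by apply: val_sumy => j ne; have [_] := xP j; apply; rewrite eq_sym.
Qed.

Lemma jump_low X (a b : point) i : X `<=` full b -> a i < b i -> jump X a i = false.
Proof.
move=> Xb lt; apply/asboolPn => -[h [/Xb[_ /(_ i)] bh _] eh].
by move: bh; rewrite eh lee_fin leNgt lt.
Qed.

Lemma jump_high X (a b : point) i :
  full b `<=` X -> (forall j, b j <= a j) -> jump X a i.
Proof.
move=> bX le_ba; have [h [eh hy]] := pv_component pv i (a i).
have ah : full a h.
  by split=> // j; case: (eqVneq j i) => [->|/hy ->]; rewrite ?eh ?leey.
apply/asboolP; exists h => //; split; last by case: ah.
exact/bX/(fil_sub le_ba ah).
Qed.

Lemma jumps_low X (a b : point) s :
  X `<=` full b -> (forall i, (a + disp s) i <= b i) -> jumps X a s = 0%N.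
Proof.
move=> Xb; elim: s a => [//|i s IH] a le_b /=.
rewrite IH ?addn0 => [|j]; last by rewrite -addrA -disp_cons.
rewrite (@jump_low X a b) //; apply: lt_le_trans (le_b i).
rewrite disp_cons addrA ffunE [X in X + _]ffunE std_basis_eq.
by rewrite -addrA ltrDl ltr_pwDl ?disp_ge0.
Qed.

Lemma jumps_high X (a b : point) s :
  full b `<=` X -> (forall i, b i <= a i) -> jumps X a s = size s.
Proof.
move=> bX; elim: s a => [//|i s IH] a le_ba /=.
rewrite (jump_high i bX le_ba) IH // => j.
exact: le_trans (le_ba j) (le_add_std _ _ _).
Qed.

Lemma jumps_le_size X a s : (jumps X a s <= size s)%N.
Proof. by elim: s a => [//|i s IH] a /=; have := IH (a + e_ i); case: jump; lia. Qed.

(** Both sides are the dimension of the quotient of [X] between the ends of the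
    path. *)
Lemma jumps_path X a s t : subspace X -> full (a + disp s) `<=` X ->
  disp s = disp t -> jumps X a s = jumps X a t.
Proof.
move=> sX; set b := a + disp s => bX e; have sb := subspace_full b.
have endX : fil X b `<=` full b by move=> x [].
have [n [f qf en]] := @basis_jumps (full b) X a s sb sX bX endX.
have et : b = a + disp t by rewrite -e.
have [|m [g qg em]] := @basis_jumps (full b) X a t sb sX bX; first by rewrite -et.
have as0 : jumps (full b) a s = 0%N by apply: (@jumps_low _ a b).
have at0 : jumps (full b) a t = 0%N by apply: (@jumps_low _ a b); rewrite -?et.
rewrite -en -em as0 at0 !addn0.
exact: quotient_basis_size (subspace_fil _ sX) (subspace_fil _ sb) qf qg.
Qed.

Lemma one_generator Y X n (b : 'I_n -> K) : (n <= 1)%N -> spans Y X b ->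
  exists g, forall y, Y y -> exists c, X (y - sc c * g).
Proof.
case: n b => [|[|//]] b _ sp.
  by exists 0 => y /sp[c]; rewrite big_ord0 => Xy; exists 0; rewrite mulr0.
by exists (b ord0) => y /sp[c]; rewrite big_ord1 => Xy; exists (c ord0).
Qed.

Lemma one_generator_size Y X n (b : 'I_n -> K) g : subspace Y -> subspace X ->
  quotient_basis iota Y X b ->
  (forall y, Y y -> exists c, X (y - sc c * g)) -> (n <= 1)%N.
Proof.
move=> sY sX /(quotient_basisP _ sY sX)[Yb _ ind] gen.
apply: (independent_le_spans sX Yb ind (b' := fun=> g)) => y /gen[c Xc].
by exists (fun=> c); rewrite big_ord1.
Qed.

Lemma path_exists (a b : point) : (forall i, a i <= b i) -> exists s, a + disp s = b.
Proof.
move=> le_ab; pose n i := `|b i - a i|%N.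
exists (flatten [seq nseq (n i) i | i <- enum 'I_r]).
apply/ffunP => j; rewrite ffunE /disp big_flatten big_map.
have -> : \sum_(i <- enum 'I_r) \sum_(l <- nseq (n i) i) e_ l = \sum_i e_ i *+ n i.
  by rewrite big_enum; apply: eq_bigr => i _; rewrite big_nseq iter_addr addr0.
rewrite sum_ffunE (bigD1 j) //= big1 ?addr0 => [|i ne].
  by rewrite ffunMnE std_basis_eq /n natz; have := le_ab j; lia.
by rewrite ffunMnE std_basis_neq ?mul0rn // eq_sym.
Qed.

(** For [a] with nonnegative entries, the length of the paths from [0] to [a]. *)
Definition norm1 (a : point) : int := \sum_i a i.

Lemma norm1D a b : norm1 (a + b) = norm1 a + norm1 b.
Proof. by rewrite /norm1 -big_split; apply: eq_bigr => i _; rewrite ffunE. Qed.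

Lemma norm1_0 : norm1 0 = 0.
Proof. by rewrite /norm1 big1 // => i _; rewrite ffunE. Qed.

Lemma norm1N a : norm1 (- a) = - norm1 a.
Proof. by rewrite /norm1 -sumrN; apply: eq_bigr => i _; rewrite ffunE. Qed.

Lemma norm1_disp s : norm1 (disp s) = (size s)%:Z.
Proof.
elim: s => [|i s IH]; first by rewrite disp_nil norm1_0.
rewrite disp_cons norm1D IH /norm1 (bigD1 i) //= std_basis_eq.
rewrite big1 ?addr0; first by lia.
by move=> j ne; rewrite std_basis_neq.
Qed.

Lemma disp_rev s : disp (rev s) = disp s.
Proof. by rewrite /disp; apply: perm_big; rewrite perm_rev. Qed.

(** The counterpart of [jumps] for the dual: when a path moves upwards from [a], its
    reflection [c - _] moves downwards from [c - a]. *)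
Fixpoint jumps_down X (a : point) s : nat :=
  if s is i :: s' then
    (jump X (a - e_ i)%R i + jumps_down X (a - e_ i)%R s')%N
  else 0%N.

Lemma jumps_downE X a s : jumps_down X a s = jumps X (a - disp s) (rev s).
Proof.
elim: s a => [|i s IH] a //=.
rewrite rev_cons -cats1 jumps_cat /= addn0 disp_rev IH disp_cons opprD addrA subrK.
by rewrite addnC.
Qed.

Lemma jumps_down_cat X a s t :
  jumps_down X a (s ++ t) = (jumps_down X a s + jumps_down X (a - disp s)%R t)%N.
Proof.
elim: s a => [|i s IH] a /=; first by rewrite disp_nil subr0.
by rewrite IH disp_cons opprD addrA addnA.
Qed.

Lemma dual_subset X Y : X `<=` Y -> dual iota Y `<=` dual iota X.
Proof. by move=> XY x Yx y /XY; apply: Yx. Qed.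

Lemma submodule_dual X : submodule iota (dual iota X).
Proof.
have [R0 RD RM] := submodule_range; split.
- by move=> y _; rewrite mul0r.
- by move=> x y dx dy z Xz; rewrite mulrDl; apply: RD; [exact: dx | exact: dy].
- by move=> a x dx z Xz; rewrite -mulrA; apply/RM/dx.
Qed.

Lemma dual_range : dual iota R = R.
Proof.
apply/seteqP; split=> [x dx|x [a _ <-] _ [b _ <-]].
  2: by exists (a * b); rewrite ?rmorphM.
by rewrite -[x]mulr1; apply: dx; exists 1; rewrite ?rmorph1.
Qed.


(** * Jumps of a dual *)

Section Duality.
(** These hypotheses characterize the conductor [c] of the value semigroup:
    [full c] is contained in [R], and no coordinate of [c] can be lowered. *)
Variable c : point.
Hypothesis full_c : full c `<=` R.
Hypothesis no_jump_below_c : forall i, ~~ jump R (c - e_ i) i.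
Hypothesis range_ge0 : R `<=` full 0.

Lemma conductor_ge0 i : 0 <= c i.
Proof.
have [h [eh hy]] := pv_component pv i (c i).
have /full_c/range_ge0[_ /(_ i)] : full c h.
  by split=> // j; case: (eqVneq j i) => [->|/hy ->]; rewrite ?eh ?leey.
by rewrite eh lee_fin ffunE.
Qed.

(** If [x] in the dual had a value below [c i - b i], multiplying it by an element
    of [full b] concentrated at [i] would give an element of [R] with value
    [c i - 1] at [i] and [+oo] elsewhere. *)
Lemma dual_subset_full X (b : point) : full b `<=` X -> dual iota X `<=` full (c - b).
Proof.
move=> bX x dx; split=> // i; rewrite !pointE.
have [vx|[n vx]] := pv_fin pv i x; first by rewrite vx leey.
rewrite vx lee_fin leNgt; apply/negP => lt_n.
have [y [vy yy]] := pv_component pv i (c i - 1 - n).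
have Rxy : R (x * y).
  apply/dx/bX; split=> // j; case: (eqVneq j i) => [->|/yy ->]; last exact: leey.
  by rewrite vy lee_fin; lia.
case/negP: (no_jump_below_c i); apply/asboolP; exists (x * y).
  split=> // j; case: (eqVneq j i) => [->|ne].
    by rewrite (pvM pv) vx vy -EFinD lee_fin !pointE std_basis_eq; lia.
  by rewrite (pvM pv) yy //; have [->|[m ->]] := pv_fin pv j x; rewrite leey.
by rewrite (pvM pv) vx vy -EFinD !pointE std_basis_eq; congr (_%:E); lia.
Qed.

Lemma full_subset_dual X (a : point) : X `<=` full a -> full (c - a) `<=` dual iota X.
Proof.
move=> Xa x [_ cx] y /Xa[_ ay]; apply: full_c; split=> // i.
have -> : c i = (c - a) i + a i by rewrite !pointE subrK.
exact: val_geM.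
Qed.

Lemma dual_full (a : point) : dual iota (full a) = full (c - a).
Proof.
apply/seteqP; split; first exact: dual_subset_full.
exact: full_subset_dual.
Qed.

(** Multiplying an element of [X] by one of its dual at the mirror place would
    produce an element of [R] with a value just below the conductor. *)
Lemma jump_dual X a i : (jump X a i + jump (dual iota X) (c - a - e_ i)%R i <= 1)%N.
Proof.
case jX: (jump X a i); last by case: (jump (dual _ _)).
case jd: (jump (dual _ _)) => //.
have [h [Xh ah] eh] := asboolW jX; have [g [dg ag] eg] := asboolW jd.
case/negP: (no_jump_below_c i); apply/asboolP; exists (g * h).
  split=> [|j]; first exact: dg.
  have -> : (c - e_ i) j = (c - a - e_ i) j + a j by rewrite !pointE; ring.
  exact: val_geM.
rewrite (pvM pv) eg eh -EFinD; congr (_%:E).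
by rewrite !pointE; ring.
Qed.

Lemma jumps_dual X a s :
  (jumps X a s + jumps_down (dual iota X) (c - a)%R s <= size s)%N.
Proof.
elim: s a => [//|i s IH] a /=.
have e : c - (a + e_ i) = c - a - e_ i by rewrite opprD addrA.
by have := jump_dual X a i; have := IH (a + e_ i); rewrite e; lia.
Qed.

Lemma jump_dual_eq X a s i t :
  (size (s ++ i :: t) <= jumps X a (s ++ i :: t) +
     jumps_down (dual iota X) (c - a)%R (s ++ i :: t))%N ->
  (jump X (a + disp s)%R i + jump (dual iota X) (c - (a + disp s) - e_ i)%R i = 1)%N.
Proof.
rewrite size_cat jumps_cat jumps_down_cat /=.
have := jumps_dual X a s; have := jump_dual X (a + disp s) i.
have := jumps_dual X (a + disp s + e_ i) t.
have -> : c - (a + disp s) = c - a - disp s by rewrite opprD addrA.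
have -> : c - (a + disp s + e_ i) = c - a - disp s - e_ i by rewrite !opprD !addrA.
lia.
Qed.

(** When [I] is generated by [h] over [J] and [m h] is contained in [J],
    multiplication by [h] sends [dual J] to [dual m], and [y] is in [dual I]
    as soon as [y h] is in [R]: so [dual J / dual I] embeds in [dual m / R], and
    has at most one generator when the latter has. *)
Lemma dual_one_generator (m I J : set K) h u :
  (forall y, dual iota m y -> exists d, R (y - sc d * u)) ->
  submodule iota J -> I h -> (forall x, I x -> exists d, J (x - sc d * h)) ->
  (forall z, m z -> J (z * h)) ->
  exists g, forall y, dual iota J y -> exists d, dual iota I (y - sc d * g).
Proof.
move=> gen sJ Ih genI mh.
have [R0 RD RZ] := subspace_range; have [_ dJD dJM] := submodule_dual J.
have dJZ d x : dual iota J x -> dual iota J (sc d * x) by exact: dJM.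
have dm y : dual iota J y -> dual iota m (y * h).
  by move=> dy z mz; rewrite -mulrA (mulrC h); apply/dy/mh.
have toI y : dual iota J y -> R (y * h) -> dual iota I y.
  move=> dy Ryh x /genI[d Jx]; rewrite -[x](subrK (sc d * h)) mulrDr.
  by apply: RD; [exact: dy | rewrite mulrCA; apply: RZ].
have [[g dg ng]|no] := pselect (exists2 g, dual iota J g & ~ R (g * h)); last first.
  exists 0 => y dy; exists 0; rewrite mulr0 subr0; apply: toI => //.
  by apply: contrapT => nR; apply: no; exists y.
have [d0 Rg] := gen _ (dm _ dg).
have d00 : d0 != 0.
  apply/eqP => d00; apply: ng; move: Rg.
  by rewrite d00 scale0r rmorph0 mul0r subr0.
exists g => y dy; have [d1 Ry] := gen _ (dm _ dy).
exists (d1 / d0); apply: toI.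
  by rewrite scN1; apply: dJD => //; apply/dJZ/dJZ.
have -> : (y - sc (d1 / d0) * g) * h =
    (y * h - sc d1 * u) - sc (d1 / d0) * (g * h - sc d0 * u).
  have -> : sc d1 = sc (d1 / d0) * sc d0 by rewrite -scM divfK.
  by ring.
exact: (subspaceB subspace_range Ry (RZ _ _ Rg)).
Qed.

Section Symmetric.
Variable s0 : seq 'I_r.
Hypothesis disp_s0 : disp s0 = c.

(** Going through [0] and [c], only the part of the path between them depends on
    [R]: below [0] it never jumps, above [c] it always does. *)
Lemma jumps_range a b s : a + disp s = b ->
  (forall i, a i <= 0) -> (forall i, c i <= b i) ->
  (jumps R a s)%:Z = (jumps R 0 s0)%:Z + norm1 b - norm1 c.
Proof.
move=> eb a0 cb.
have [sa ea] : exists s, a + disp s = 0 by apply: path_exists => i; rewrite ffunE.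
have [sb esb] := path_exists cb.
have e : disp s = disp (sa ++ s0 ++ sb).
  by apply: (addrI a); rewrite !disp_cat !addrA ea add0r disp_s0 esb.
rewrite (jumps_path subspace_range _ e); last first.
  by rewrite eb => x bx; apply/full_c/(fil_sub cb).
rewrite !jumps_cat ea add0r disp_s0 (@jumps_low _ a 0) ?ea // add0n.
rewrite (@jumps_high _ c c sb) // PoszD -norm1_disp.
have -> : disp sb = b - c by rewrite -esb addrC addKr.
by rewrite norm1D norm1N addrA.
Qed.

Hypothesis symmetric : (2 * jumps R 0%R s0 = size s0)%N.

(** [R] is its own dual, and the mirror image of a path around [c] is again a path
    from a point below [0] to a point above [c]; both counts are thus given by
    [jumps_range]. *)
Lemma jumps_range_dual a b s : a + disp s = b ->
  (forall i, a i <= 0) -> (forall i, c i <= b i) ->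
  (jumps R a s + jumps_down R (c - a)%R s = size s)%N.
Proof.
move=> eb a0 cb; rewrite jumps_downE.
have e1 := jumps_range eb a0 cb.
have e2 : (jumps R (c - a - disp s) (rev s))%:Z =
    (jumps R 0 s0)%:Z + norm1 (c - a) - norm1 c.
  apply: jumps_range; first by rewrite disp_rev subrK.
    move=> i; have := cb i; rewrite -eb !pointE; lia.
  by move=> i; have := a0 i; rewrite !pointE; lia.
have e3 : norm1 a + (size s)%:Z = norm1 b by rewrite -norm1_disp -norm1D eb.
have e4 : (size s0)%:Z = norm1 c by rewrite -norm1_disp disp_s0.
move: e2; rewrite norm1D norm1N; lia.
Qed.

Let one : point := [ffun=> 1].
Let maxid := fil R one.
Hypothesis local : forall x, R x -> exists d, maxid (x - sc d).

Lemma submodule_fil X a : submodule iota X -> submodule iota (fil X a).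
Proof.
case=> X0 XD XM.
have [f0 fD _] := subspace_fil a (submodule_subspace (And3 X0 XD XM)).
split=> // d x [Xx ax]; split=> [|i]; first exact: XM.
rewrite -[a i]add0r; apply: val_geM => //.
by have [_ /(_ i)] := range_ge0 (imageT iota d); rewrite ffunE.
Qed.

Lemma max_ideal_step X a i x z : submodule iota X -> fil X a x -> maxid z ->
  fil X (a + e_ i) (z * x).
Proof.
move=> [_ _ XM] [Xx ax] [[w _ <-] wz]; split=> [|j]; first exact: XM.
rewrite ffunE addrC; apply: val_geM => //; apply: val_ge_trans (wz j).
by rewrite !ffunE; case: (j == i).
Qed.

(** A symmetric [R] has Cohen-Macaulay type one. The jumps of [R] and of its
    dual fill the path, and those of [m] and of its dual cannot exceed its
    length; as [m] has one jump less than [R], its dual has at most one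
    more. *)
Lemma dual_max_ideal_one_generator :
  exists u, forall y, dual iota maxid y -> exists d, R (y - sc d * u).
Proof.
pose b : point := [ffun i => Num.max (c i) 1].
have cb i : c i <= b i by rewrite ffunE le_max lexx.
have b1 i : one i <= b i by rewrite !ffunE le_max lexx orbT.
have sR := subspace_range; have sm : subspace maxid by exact: subspace_fil.
have [s eb] : exists s, 0 + disp s = b.
  by apply: path_exists => i; rewrite !ffunE le_max orbC ler01.
have bm : full b `<=` maxid.
  move=> x bx; split; first exact/full_c/(fil_sub cb bx).
  by case: (fil_sub b1 bx).
have mR : maxid `<=` R by move=> x [].
have [|n [f qf en]] := @basis_jumps maxid R 0 s sm sR mR.
  by rewrite eb => x [_ bx]; apply: bm.
have n1 : (n <= 1)%N.
  apply: (one_generator_size (g := 1) _ _ qf); try exact: subspace_fil.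
  move=> y [Ry y0]; have [d md] := local Ry; exists d; rewrite mulr1; split=> //.
  case: md => _ md i; apply: val_ge_trans (md i); by rewrite !ffunE.
have le1 := jumps_dual maxid 0 s.
have a0 i : (0 : point) i <= 0 by rewrite ffunE.
have eR := jumps_range_dual eb a0 cb.
set g := c - 0 - disp s.
have eg : g = c - b by rewrite /g subr0 -eb add0r.
have sd : subspace (dual iota maxid) by exact/submodule_subspace/submodule_dual.
have Rd : R `<=` dual iota maxid.
  by rewrite -[X in X `<=` _]dual_range; exact: dual_subset.
have [|n' [f' qf' en']] := @basis_jumps R (dual iota maxid) g (rev s) sR sd Rd.
  by rewrite disp_rev subrK subr0 => x [_ bx]; apply: full_c.
have n'1 : (n' <= 1)%N by move: le1 eR; rewrite !jumps_downE -/g; lia.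
have /(quotient_basisP _ (subspace_fil _ sd) (subspace_fil _ sR))[_ sp _] := qf'.
have [u genu] := one_generator n'1 sp; exists u => y dy.
have [d [Rd' _]] : exists d, fil R g (y - sc d * u); last by exists d.
apply: genu; split=> //; rewrite eg.
by case: (dual_subset_full bm dy).
Qed.

(** The dual of the truncation of [X] at a point grows with the point, by at
    most one dimension where [X] jumps and not at all elsewhere. *)
Lemma jumps_down_dual_le X (a b al : point) s t : submodule iota X ->
  full b `<=` X -> X `<=` full a -> a + disp s = b ->
  (forall i, (al + disp t) i <= b i) ->
  (jumps_down (dual iota (fil X (al + disp t)%R)) (c - a)%R s <=
   jumps_down (dual iota (fil X al)) (c - a)%R s + jumps X al t)%N.
Proof.
move=> sX bX Xa eb; elim: t al => [|i t IH] al le_b.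
  by rewrite disp_nil addr0 addn0.
rewrite disp_cons addrA; apply: leq_trans (IH _ _) _.
  by move=> j; rewrite -addrA -disp_cons.
rewrite /= addnA leq_add2r.
have [jX|jX] := boolP (jump X al i); last first.
  rewrite (_ : fil X (al + e_ i) = fil X al) ?leq_addr //.
  by apply/seteqP; split; [exact: fil_sub (@le_add_std al i) | exact: no_jump].
have le_al j : al j <= b j.
  apply: le_trans (le_b j); rewrite ffunE lerDl; exact: disp_ge0.
have [h ah eh] := asboolW jX.
set I := fil X al; set J := fil X (al + e_ i).
have JI : J `<=` I by exact: fil_sub (@le_add_std al i).
have sI : submodule iota I by exact: submodule_fil.
have sJ : submodule iota J by exact: submodule_fil.
have sdI := submodule_subspace (submodule_dual I).
have sdJ := submodule_subspace (submodule_dual J).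
have [u genu] := dual_max_ideal_one_generator.
have [g geng] : exists g, forall y, dual iota J y ->
    exists d, dual iota I (y - sc d * g).
  apply: (dual_one_generator genu sJ ah) => [x Ix|z mz].
    exact: (jump_step (submodule_subspace sX) (@subset_refl _ X) ah eh).
  exact: max_ideal_step.
have IJ : dual iota I `<=` dual iota J by exact: dual_subset.
have Ia : I `<=` full a by move=> x [/Xa].
have bI : full b `<=` I.
  by move=> x bx; split; [exact: bX | case: (fil_sub le_al bx)].
have [|n [f qf en]] := @basis_jumps _ _ (c - a - disp s) (rev s) sdI sdJ IJ.
  by rewrite disp_rev subrK => x [_ bx]; apply: (full_subset_dual Ia).
have n1 : (n <= 1)%N.
  apply: (one_generator_size (g := g) _ _ qf); try exact: subspace_fil.
  move=> y [dy _]; have [d Iy] := geng y dy; exists d; split=> //.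
  have [_] := dual_subset_full bI Iy; rewrite -eb opprD addrA; apply.
rewrite !jumps_downE -en; lia.
Qed.

(** Follow a path through [a] that starts below [X] and ends at some [b'] with
    [full b'] inside [X]. The last truncation of [X] is [full b'], whose dual
    [full (c - b')] jumps at every step of the mirror path; since each jump of
    [X] accounts for at most one of these, the jumps of [X] and of its dual fill
    the path, which leaves exactly one for each step. *)
Lemma jump_dual_symmetric X a0 b0 a i : submodule iota X ->
  full b0 `<=` X -> X `<=` full a0 ->
  (jump X a i + jump (dual iota X) (c - a - e_ i)%R i = 1)%N.
Proof.
move=> sX bX Xa.
pose a' : point := [ffun j => Num.min (a j) (a0 j)].
pose b' : point := [ffun j => Num.max ((a + e_ i) j) (b0 j)].
have [s es] : exists s, a' + disp s = a.
  by apply: path_exists => j; rewrite ffunE ge_min lexx.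
have [t et] : exists s, a + e_ i + disp s = b'.
  by apply: path_exists => j; rewrite [b' j]ffunE le_max lexx.
rewrite -es; apply: jump_dual_eq (t) _; set p := s ++ i :: t.
have ep : a' + disp p = b' by rewrite disp_cat disp_cons !addrA es.
have Xa' : X `<=` full a'.
  by move=> x /Xa; apply: fil_sub => j; rewrite ffunE ge_min lexx orbT.
have bX' : full b' `<=` X.
  by move=> x bx; apply/bX/(fil_sub _ bx) => j; rewrite [b' j]ffunE le_max lexx orbT.
have := @jumps_down_dual_le X a' b' a' p p sX bX' Xa' ep.
rewrite ep => /(_ (fun=> lexx _)).
rewrite (fil_low Xa').
have -> : fil X b' = full b'.
  by apply/seteqP; split=> x; [case | move=> bx; split; [exact: bX' | case: bx]].
rewrite dual_full (jumps_downE (full _)) -{1}ep opprD addrA.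
rewrite (@jumps_high _ _ (c - a' - disp p)) //.
by rewrite size_rev addnC.
Qed.

End Symmetric.
End Duality.

(** * Lengths and the Gorenstein condition *)

Lemma val_one i : v i 1 = 0%E.
Proof. by rewrite -sc1 (pv_const pv) // oner_neq0. Qed.

Lemma val_unit i x : x \is a GRing.unit -> exists n : int, v i x = n%:E.
Proof.
move=> ux; have := val_one i; rewrite -(divrr ux) (pvM pv).
by have [->|//] := pv_fin pv i x; have [->|[m ->]] := pv_fin pv i x^-1.
Qed.

Lemma val_unit_point x : x \is a GRing.unit ->
  exists a : point, forall i, v i x = (a i)%:E.
Proof.
move=> ux; have /choice[a va] := fun i => val_unit i ux.
by exists [ffun i => a i] => i; rewrite ffunE.
Qed.

Lemma val_divr i x y (m n : int) : y \is a GRing.unit -> v i y = n%:E ->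
  ((m + n)%:E <= v i x)%E -> (m%:E <= v i (x / y))%E.
Proof.
move=> uy vy.
have -> : v i x = (v i (x / y) + n%:E)%E by rewrite -vy -(pvM pv) divrK.
by have [->|[l ->]] := pv_fin pv i (x / y); rewrite ?leey // -EFinD !lee_fin lerD2r.
Qed.

(** If [s] is a regular element of [I] and [d I] is contained in [R], then [I]
    contains [s (full c)] and is contained in [d^-1 (full 0)]. *)
Lemma fractional_ideal_bounded (c : point) I :
  (forall s, GRing.lreg s -> iota s \is a GRing.unit) ->
  R `<=` full 0 -> full c `<=` R -> fractional_ideal iota I ->
  exists a b : point, full b `<=` I /\ I `<=` full a.
Proof.
move=> unitR R0 cR [[_ _ IM] [s /unitR us Is] [d /unitR ud Id]].
have [p vs] := val_unit_point us; have [q vd] := val_unit_point ud.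
exists (- q), (c + p); split=> [x [_ bx]|x Ix].
  have [w _ ew] : R (x / iota s).
    apply: cR; split=> // i; apply: val_divr us (vs i) _.
    by have := bx i; rewrite pointE.
  by rewrite -[x](divrK us) -ew; apply: IM.
split=> // i; have [_ /(_ i)] := R0 _ (Id x Ix); rewrite pointE => h.
rewrite -[x](mulKr ud) mulrC; apply: val_divr ud (vd i) _.
by rewrite pointN addNr.
Qed.

Lemma strict_chain_subset (M : set K) n (F : nat -> set K) : F n = M ->
  (forall j, (j < n)%N -> F j `<` F j.+1) -> forall j, (j <= n)%N -> F j `<=` M.
Proof.
move=> <- lt j le_jn; rewrite -(subnKC le_jn); move: (n - j)%N (subnKC le_jn) => l.
elim: l n lt {le_jn} => [|l IH] n lt e; first by rewrite addn0.
apply: (@subset_trans _ (F (j + l)%N)).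
  by apply: (IH n.-1) => [i hi|]; [apply: lt|]; lia.
by rewrite addnS; apply: (lt _ _).1; lia.
Qed.

(** At a jump the quotient is a line over [k], hence a simple module, because
    the constants act on it through [R]. *)
Lemma quotient_length_step X a i : R `<=` full 0 -> submodule iota X ->
  quotient_length iota (fil X a) (fil X (a + e_ i)) = (jump X a i : nat)%:Z%:E.
Proof.
move=> R0 sX; have sf b' := submodule_fil R0 b' sX.
have sXk := submodule_subspace sX.
set M := fil X a; set N := fil X (a + e_ i).
have NM : N `<=` M by exact: fil_sub (@le_add_std a i).
have [/asboolW[h ah eh]|/no_jump MN] := boolP (jump X a i); last first.
  have e : M = N by apply/seteqP.
  have chain0 n : strict_chain iota M N n -> n = 0%N.
    case: n => // n [F [F0 Fn _ lt]].
    have [_] := lt 0%N isT; case; rewrite F0 -e.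
    exact: (strict_chain_subset Fn lt).
  apply: nat_or_oo_unique; last by move=> m [/chain0].
  split=> [|m /chain0 ->//]; exists (fun=> N); split=> // j _; exact: sf.
have Nh : ~ N h by move=> /fil_stepP[_]; rewrite (val_eq_geF eh).
have simple J : submodule iota J -> N `<=` J -> J `<=` M -> J <> N -> J = M.
  move=> sJ NJ JM ne; have sJk := submodule_subspace sJ.
  have [z Jz Nz] : exists2 z, J z & ~ N z.
    apply: contrapT => no; apply: ne; apply/seteqP; split=> // z Jz.
    by apply: contrapT => nN; apply: no; exists z.
  have [d Nd] := jump_step sXk (@subset_refl _ X) ah eh (JM _ Jz).
  have Jdh : J (sc d * h).
    by rewrite -[_ * h](subKr z); apply: subspaceB => //; apply: NJ.
  have d0 : d != 0.
    by apply/eqP => d0; apply: Nz; move: Nd; rewrite d0 scale0r rmorph0 mul0r subr0.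
  have Jh : J h.
    have [_ _ /(_ d^-1 _ Jdh)] := sJk.
    by rewrite mulrA -scM mulVf // sc1 mul1r.
  apply/seteqP; split=> // x Mx.
  have [d' Nd'] := jump_step sXk (@subset_refl _ X) ah eh Mx.
  have [_ JD JZ] := sJk; rewrite -[x](subrK (sc d' * h)); apply: JD; first exact: NJ.
  exact: JZ.
have chain1 n : strict_chain iota M N n -> (n <= 1)%N.
  case: n => [|[|n]] // [F [F0 Fn sF lt]].
  have FM := strict_chain_subset Fn lt.
  have lt0 := lt 0%N isT; rewrite F0 in lt0.
  have e1 : F 1%N = M.
    apply: simple; [exact: sF | exact: lt0.1 | exact: FM |].
    by move=> e; apply: lt0.2; rewrite e.
  by case: (lt 1%N isT) => _ []; rewrite e1; apply: FM.
have chain : strict_chain iota M N 1.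
  exists (fun j => if j is 0 then N else M); split=> // [[|[|//]] _|[|//] _]; try exact: sf.
  by split=> // MN; apply/Nh/MN.
apply: nat_or_oo_unique; first by split=> // m; exact: chain1.
move=> m [/chain1 m1 /(_ _ chain)]; lia.
Qed.

Section Gorenstein.
Variable c : point.
Hypothesis lreg_unit : forall s, GRing.lreg s -> iota s \is a GRing.unit.
Hypothesis range_ge0 : R `<=` full 0.
Hypothesis local : forall x, R x -> exists d, fil R [ffun=> 1] (x - sc d).
Hypothesis closureE : integral_closure iota = full 0.
Hypothesis full_c : full c `<=` R.
Hypothesis no_jump_below_c : forall i, ~~ jump R (c - e_ i) i.

(** On a path from [0] to [c], the dimension of [R / full c] is the number of
    jumps of [R], and that of [full 0 / R] the number of its other steps. *)
Lemma gorensteinP s : disp s = c ->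
  gorenstein iota <-> (2 * jumps R 0%R s = size s)%N.
Proof.
move=> es; have c0 := conductor_ge0 full_c range_ge0.
have sR := subspace_range; have sfc := subspace_full c; have sf0 := subspace_full 0.
rewrite /gorenstein closureE.
have -> : conductor_ideal iota = full c.
  rewrite -[c]subr0 -(dual_full full_c no_jump_below_c) -closureE //.
have fc0 : full c `<=` full 0 by apply: fil_sub => i; rewrite pointE.
have [|n [f qf en]] := @basis_jumps (full c) R 0 s sfc sR full_c.
  by rewrite add0r es => x [].
have [|m [g qg em]] := @basis_jumps R (full 0) 0 s sR sf0 range_ge0.
  by rewrite add0r es => x [_ bx]; apply: full_c.
rewrite (fil_low range_ge0) (fil_low fc0) in qf.
rewrite (fil_low range_ge0) (fil_low (@subset_refl _ (full 0))) in qg.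
rewrite (quotient_dimE sR sfc qf) (quotient_dimE sf0 sR qg).
move: en; rewrite (@jumps_low _ 0 c) ?add0r ?es // addn0 => ->.
move: em; rewrite (@jumps_high (full 0) 0 0) // => <-.
split=> [[->]|e]; first by lia.
by congr (_%:E); lia.
Qed.

(** Summed over a path from [0] to [c], the length equation for [I = R] counts the
    jumps of [R] twice, since [R] is its own dual and the mirror image of the
    path joins the same ends. *)
Theorem gorenstein_length :
  (forall I, fractional_ideal iota I -> forall a i,
     (quotient_length iota (fil I a) (fil I (a + e_ i)%R)
      + quotient_length iota (fil (dual iota I) (c - a - e_ i)%R)
                             (fil (dual iota I) (c - a)%R))%E = 1%:E)
  <-> gorenstein iota.
Proof.
have c0 := conductor_ge0 full_c range_ge0.
have [s es] : exists s, 0 + disp s = c by apply: path_exists => i; rewrite pointE.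
rewrite add0r in es; rewrite (gorensteinP es).
have lengthE I : submodule iota I -> forall a i,
    (quotient_length iota (fil I a) (fil I (a + e_ i)%R)
      + quotient_length iota (fil (dual iota I) (c - a - e_ i)%R)
                             (fil (dual iota I) (c - a)%R))%E =
    (jump I a i + jump (dual iota I) (c - a - e_ i)%R i)%N%:Z%:E.
  move=> sI a i; rewrite -{2}[c - a](subrK (e_ i)).
  by rewrite !quotient_length_step //; exact: submodule_dual.
split=> [all|sym I fI a i].
  have fR : fractional_ideal iota R.
    split; first exact: submodule_range.
      by exists 1; [exact: lreg1 | exists 1].
    by exists 1 => [|x Rx]; [exact: lreg1 | rewrite rmorph1 mul1r].
  have one a i : (jump R a i + jump R (c - a - e_ i)%R i = 1)%N.
    have := all _ fR a i; rewrite lengthE; last exact: submodule_range.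
    by rewrite dual_range => -[].
  have sum t a : (jumps R a t + jumps_down R (c - a)%R t = size t)%N.
    elim: t a => [//|i t IH] a /=; rewrite addnACA (one a i).
    by rewrite -(IH (a + e_ i)) opprD addrA.
  have := sum s 0; rewrite jumps_downE subr0 es subrr.
  have -> : jumps R 0 (rev s) = jumps R 0 s.
    by apply: jumps_path; rewrite ?disp_rev ?es ?add0r //; exact: subspace_range.
  by lia.
have [a0 [b0 [bI Ia]]] := fractional_ideal_bounded lreg_unit range_ge0 full_c fI.
have [sI _ _] := fI; rewrite lengthE //.
by rewrite (jump_dual_symmetric full_c no_jump_below_c range_ge0 es sym local
  a i sI bI Ia).
Qed.

End Gorenstein.

(** * Existence of the conductor *)

Definition value_set : set point :=
  [set a | exists2 x, R x & forall i, v i x = (a i)%:E].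

(** All the values above [g] being values of [R], the subspace [R `&` full g]
    jumps at every step above [g], just as [full g] does; and they agree
    above [d]. *)
Lemma full_of_value_set (g d : point) : R `<=` full 0 -> full d `<=` R ->
  (forall a : point, (forall i, g i <= a i) -> value_set a) -> full g `<=` R.
Proof.
move=> R0 dR gS; pose b : point := [ffun i => Num.max (g i) (d i)].
have [s es] : exists s, g + disp s = b.
  by apply: path_exists => i; rewrite ffunE le_max lexx.
have XY : R `&` full g `<=` full g by move=> x [].
have sI : subspace (R `&` full g).
  have [r0 rD rZ] := subspace_range; have [f0 fD fZ] := subspace_full g.
  by split=> // [x y [? ?] [? ?]|z x [? ?]]; split; auto.
have sg := subspace_full g.
have [|n [f qf en]] := @basis_jumps _ _ g s sI sg XY.
  rewrite es => x [gx bx]; split=> //; apply: dR; split=> // i.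
  by apply: val_ge_trans (bx i); rewrite ffunE le_max lexx orbT.
have js : jumps (R `&` full g) g s = size s.
  suff all t : forall a : point, (forall i, g i <= a i) ->
      jumps (R `&` full g) a t = size t by exact: all.
  elim: t => [//|i t IH] a ga /=; rewrite IH; last first.
    by move=> j; apply: le_trans (ga j) (le_add_std _ _ _).
  have [x Rx vx] := gS a ga.
  suff -> : jump (R `&` full g) a i by [].
  apply/asboolP; exists x => //; split=> [|j]; last by rewrite vx.
  by split=> //; split=> // j; rewrite vx lee_fin.
have n0 : n = 0%N by have := jumps_le_size (full g) g s; lia.
subst n.
have /(quotient_basisP _ (subspace_fil _ sg) (subspace_fil _ sI))[_ sp _] := qf.
move=> x gx; have [|c] := sp x; first by split; [|case: gx].
by rewrite big_ord0 subr0 => -[[]].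
Qed.

(** Take for [c i] the least [n] such that all elements of value at least [n] at
    [i] and with zero other components are in [R]. Splitting an element of
    [full c] into its components shows that it is in [R]. *)
Lemma conductor_exists (d : point) : R `<=` full 0 -> full d `<=` R ->
  exists c : point, [/\ full c `<=` R, forall i, ~~ jump R (c - e_ i) i
    & is_conductor value_set c].
Proof.
move=> R0 dR.
pose comp i (n : int) := forall y, (n%:E <= v i y)%E ->
  (forall j, j != i -> v j y = +oo%E) -> R y.
have comp_full i (a : point) : full a `<=` R -> comp i (a i).
  move=> aR y ay yy; apply: aR; split=> // j.
  by case: (eqVneq j i) => [->//|/yy ->]; rewrite leey.
have ge0 i n : comp i n -> 0 <= n.
  move=> cn; have [y [vy yy]] := pv_component pv i n.
  have /R0[_ /(_ i)] : R y by apply: cn => //; rewrite vy.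
  by rewrite vy lee_fin pointE.
have ex i : exists n : nat, `[< comp i n%:Z >].
  exists `|d i|%N; apply/asboolP; have cd := comp_full i _ dR.
  by rewrite gez0_abs //; apply: ge0 cd.
pose c : point := [ffun i => (ex_minn (ex i))%:Z].
have cP i : comp i (c i).
  by rewrite ffunE; case: ex_minnP => n /asboolW.
have cmin i n : comp i n -> c i <= n.
  move=> cn; rewrite ffunE; case: ex_minnP => m _ /(_ `|n|%N).
  by have n0 := ge0 _ _ cn; rewrite -lez_nat gez0_abs // => ->//; apply/asboolP.
have cR : full c `<=` R.
  have [e [e1 eP]] := pv_idem pv.
  move=> y [_ cy]; rewrite -[y]mul1r -e1 mulr_suml.
  have [r0 rD _] := subspace_range; apply: (big_ind R) => // i _; apply: (cP i).
    by rewrite -[c i]add0r; apply: val_geM => //; case: (eP i) => ->.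
  move=> j ne; rewrite (pvM pv); have [_ /(_ _ ne) ->] := eP i.
  by have [->|[n ->]] := pv_fin pv j y.
exists c; split=> //.
  (* With such a [u] in [R], the choice of [c i] could be lowered by one. *)
  move=> i; apply/asboolPn => -[u [Ru cu] eu].
  have : comp i (c i - 1).
    move=> y cy yy; have eu' : v i u = (c i - 1)%:E.
      by rewrite eu !pointE std_basis_eq.
    have [z cz] := pv_residue pv cy eu'.
    rewrite -[y](subrK (sc z * u)); have [_ rD rZ] := subspace_range.
    apply: rD; last exact: rZ.
    apply: cR; split=> // j.
    case: (eqVneq j i) => [->|ne]; first by rewrite subrK in cz.
    apply: (pvD pv); first by rewrite yy ?leey.
    rewrite scN1; do 2!apply: val_ge_scale.
    by have := cu j; rewrite !pointE std_basis_neq // subr0.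
  by move/cmin; lia.
have inS a : (forall i, c i <= a i) -> value_set a.
  move=> ca; have [x vx] := val_surj a; exists x => //; apply: cR.
  by split=> // i; rewrite vx lee_fin.
split; first by split=> [|n]; apply: inS => i; rewrite ?ffunE ?lerDl.
move=> g [gS gnS] i; apply/cmin/comp_full/(full_of_value_set R0 dR) => a ga.
have -> : a = [ffun i => g i + ([ffun i => absz (a i - g i)%R] i)%:Z].
  by apply/ffunP => j; rewrite !ffunE gez0_abs ?subr_ge0 ?ga // addrC subrK.
exact: gnS.
Qed.

Lemma is_conductor_unique (S : set point) (a b : point) :
  is_conductor S a -> is_conductor S b -> a = b.
Proof.
move=> [aS amin] [bS bmin]; apply/ffunP => i; apply: le_anti.
by rewrite amin ?bmin.
Qed.

Section FiniteClosure.
Variable m : set O.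
Hypothesis m_mul : forall w y, m y -> m (w * y).
Hypothesis m_complete : adically_complete m.
Hypothesis m_pos : forall z, m z -> forall i, (1%:E <= v i (iota z))%E.
Hypothesis range_ge0 : R `<=` full 0.

Lemma val_ideal_pow n z i : ideal_pow m n z -> (n%:Z%:E <= v i (iota z))%E.
Proof.
elim: n z => [|n IH] z.
  by move=> _; have [_ /(_ i)] := range_ge0 (imageT iota z); rewrite pointE.
case=> s sm ->; rewrite rmorph_sum /=; elim: s sm => [|p s IHs] sm.
  by rewrite big_nil (pv0 pv) leey.
rewrite big_cons; apply: (pvD pv); last first.
  by apply: IHs => q qs; apply: sm; rewrite inE qs orbT.
have [mp1 mp2] : m p.1 /\ ideal_pow m n p.2 by apply: sm; rewrite inE eqxx.
rewrite rmorphM intS; apply: val_geM; [exact: m_pos | exact: IH].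
Qed.

(** Completeness lifts generators of [full 0 / x (full 0)] over [k] to
    generators of [full 0] over [R]: the coefficients are power series in [x]. *)
Lemma closure_finite x : m x -> iota x \is a GRing.unit ->
  exists n (f : 'I_n -> K), forall y, full 0 y ->
    exists l : 'I_n -> O, y = \sum_(j < n) iota (l j) * f j.
Proof.
move=> mx ux; set t := iota x; have [p vt] := val_unit_point ux.
have [s es] : exists s, 0 + disp s = p.
  apply: path_exists => i; rewrite pointE; have := m_pos mx i.
  by rewrite -/t vt lee_fin; apply: le_trans.
have p0 : full p `<=` full 0.
  apply: fil_sub => i; rewrite pointE; have := m_pos mx i.
  by rewrite -/t vt lee_fin; apply: le_trans.
have [|n [f qf _]] :=
    @basis_jumps (full p) (full 0) 0 s (subspace_full p) (subspace_full 0) p0.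
  by rewrite es => y [].
have s0 := subspace_fil 0 (subspace_full 0).
have sp := subspace_fil 0 (subspace_full p).
have [f0 gen _] := (quotient_basisP f s0 sp).1 qf.
have /choice[D DP] : forall y, exists cy : ('I_n -> k) * K, full 0 y ->
    full 0 cy.2 /\ y = \sum_(j < n) sc (cy.1 j) * f j + t * cy.2.
  move=> y; have [y0|ny] := pselect (full 0 y); last by exists (fun=> 0, 0).
  have [|c [yc _]] := gen y; first by split=> //; case: y0.
  exists (c, (y - \sum_(j < n) sc (c j) * f j) / t) => _ /=; split.
    split=> // i; apply: val_divr ux (vt i) _; rewrite pointE add0r.
    by case: yc.
  by rewrite mulrCA divrr // mulr1 addrC subrK.
(* [z l] is the quotient left after [l] divisions by [t], and [u j] the sequence
   of partial sums of the coefficient of [f j]. *)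
exists n, f => y y0; pose z l := iter l (fun w => (D w).2) y.
have z0 l : full 0 (z l).
  by elim: l => [//|l IH] /=; case: (DP _ IH).
pose u j N := \sum_(l < N) ((D (z l)).1 j)%:A * x ^+ l.
have zE N : y = \sum_(j < n) iota (u j N) * f j + t ^+ N * z N.
  elim: N => [|N IH].
    rewrite expr0 mul1r big1 ?add0r // => j _.
    by rewrite /u big_ord0 rmorph0 mul0r.
  have [_ e] := DP _ (z0 N); rewrite {1}IH {1}e mulrDr addrA; congr (_ + _).
    rewrite mulr_sumr -big_split; apply: eq_bigr => j _ /=.
    rewrite /u big_ord_recr /= rmorphD rmorphM rmorphXn mulrDl.
    by congr (_ + _); rewrite mulrCA mulrA.
  by rewrite exprSr mulrA.
have /choice[l lP] : forall j, exists l, forall N, ideal_pow m N (l - u j N).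
  move=> j; have [N|l [lim _]] := m_complete (u := u j); last by exists l.
  rewrite /u big_ord_recr /= addrAC subrr add0r.
  exact/ideal_powM/ideal_powX.
exists l; apply/eqP; rewrite -subr_eq0; apply/eqP/(pv_sep pv) => i.
have zero (N : nat) : (N%:Z%:E <= v i (y - \sum_(j < n) iota (l j) * f j))%E.
  have -> : y - \sum_(j < n) iota (l j) * f j =
      t ^+ N * z N - \sum_(j < n) iota (l j - u j N) * f j.
    rewrite {1}(zE N) addrAC addrC; congr (_ + _).
    rewrite -sumrB -sumrN; apply: eq_bigr => j _.
    by rewrite rmorphB mulrBl opprB.
  apply: (pvD pv).
    rewrite -rmorphXn -[N%:Z]addr0; apply: val_geM.
      exact/val_ideal_pow/ideal_powX.
    by have [_ /(_ i)] := z0 N; rewrite pointE.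
  rewrite scN1; apply: val_ge_scale.
  apply: (big_ind (fun w => (N%:Z%:E <= v i w)%E)).
  - by rewrite (pv0 pv) leey.
  - by move=> w w' hw hw'; apply: (pvD pv).
  move=> j _; rewrite -[N%:Z]addr0; apply: val_geM; first exact/val_ideal_pow/lP.
  by have [_ /(_ i)] := f0 j; rewrite pointE.
have [//|[e ve]] := pv_fin pv i (y - \sum_(j < n) iota (l j) * f j).
have := zero `|e|.+1%N; rewrite ve lee_fin; lia.
Qed.

(** A common denominator of the generators of [full 0] multiplies [full 0]
    into [R]. *)
Lemma closure_conductor x : m x -> iota x \is a GRing.unit ->
  (forall y, exists w s, iota s \is a GRing.unit /\ y = iota w / iota s) ->
  exists d : point, full d `<=` R.
Proof.
move=> mx ux fracK; have [n [f gen]] := closure_finite mx ux.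
have /choice[w /choice[s ws]] := fun j => fracK (f j).
pose s' := \prod_(j < n) s j.
have us' : iota s' \is a GRing.unit.
  rewrite rmorph_prod; apply: (big_ind (fun z => z \is a GRing.unit)) => [||j _].
  - exact: unitr1.
  - by move=> z z' hz hz'; rewrite unitrM hz.
  - by case: (ws j).
have [d vd] := val_unit_point us'; exists d => y [_ dy].
have [|l el] := gen (y / iota s').
  by split=> // i; apply: val_divr us' (vd i) _; rewrite pointE add0r.
rewrite -[y](divrK us') el mulr_suml; have [r0 rD _] := subspace_range.
apply: (big_ind R) => // j _; exists (l j * w j * \prod_(i < n | i != j) s i) => //.
have [usj ->] := ws j.
have -> : s' = s j * \prod_(i < n | i != j) s i by rewrite /s' (bigD1 j).
by rewrite !rmorphM /= -!mulrA mulKr.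
Qed.

End FiniteClosure.

End ValuedAlgebra.

(** * The total ring of fractions of an algebroid curve *)

Section CurveValuation.
Variables (k : closedFieldType) (O : comAlgType k).
Hypothesis hO : algebroid_curve O.
Variables (r : nat) (P : 'I_r -> set O).
Hypothesis hP : minimal_primes_enum P.
Variables (K : comUnitRingType) (iota : {rmorphism O -> K}).
Hypothesis hK : total_fraction_ring iota.
Variables (Ki : 'I_r -> fieldType) (prj : forall i, {rmorphism K -> Ki i}).
Hypothesis hKi : forall i, fraction_field_mod (P i) (prj i \o iota).
Variable psi : forall i, {rmorphism Ki i -> laurent k}.
Hypothesis hpsi : forall i, normalization_iso (prj i \o iota) (psi i).

Local Notation R := (range iota).
Local Notation sc c := (iota (c%:A)).
Local Notation v := (fun i h => laurent_val (psi i (prj i h))).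

Lemma minimal_primes_prime i :
  [/\ P i 0, ~ P i 1, forall a u w, P i u -> P i w -> P i (a * u + w)
    & forall x y, P i (x * y) -> P i x \/ P i y].
Proof.
have [_ min] := hP.
have [/prime_idealP[/idealrP[P0 P1 PD] Pp] _] : minimal_prime (P i).
  by apply/min; exists i.
by split.
Qed.

Lemma minimal_primesM i x y : P i y -> P i (x * y).
Proof.
case: (minimal_primes_prime i) => P0 _ PD _ Py.
by rewrite -[_ * _]addr0; apply: PD.
Qed.

Lemma minimal_primes_inter x : (forall i, P i x) -> x = 0.
Proof.
move=> Px; apply: contrapT => x0.
have [Q [/(hP.2 _)[i eQ] nQ]] := reduced_minimal_prime (curve_reduced hO) x0.
by apply: nQ; rewrite -eQ.
Qed.

(** No minimal prime contains another one, so products of elements chosen outside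
    [P i] and in the other primes separate the minimal primes. *)
Lemma minimal_primes_separate :
  exists b : 'I_r -> O, forall i, ~ P i (b i) /\ forall j, j != i -> P j (b i).
Proof.
suff sep i : exists b, ~ P i b /\ forall j, j != i -> P j b.
  by have /choice[b bP] := sep; exists b.
have /choice[a aP] : forall j, exists a, j != i -> P j a /\ ~ P i a.
  move=> j; have [->|ne] := eqVneq j i; first by exists 0.
  apply: contrapT => no; case/eqP: ne; apply: hP.1.
  have [_ min] : minimal_prime (P i) by apply/(hP.2 _); exists i.
  apply: min => [|x Pjx].
    by have [] : minimal_prime (P j) by apply/(hP.2 _); exists j.
  by apply: contrapT => nPx; apply: no; exists x.
exists (\prod_(j | j != i) a j); split; last first.
  move=> j ne; rewrite (bigD1 j) //= mulrC; apply: minimal_primesM.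
  by case: (aP j ne).
have [_ P1 _ Pp] := minimal_primes_prime i.
apply: (big_ind (fun x => ~ P i x)).
- by [].
- by move=> x y nx ny /Pp[].
- by move=> j ne; case: (aP j ne).
Qed.

Lemma lreg_off_primes a : (forall i, ~ P i a) -> GRing.lreg a.
Proof.
move=> nPa x y e; apply/eqP; rewrite -subr_eq0; apply/eqP.
apply: minimal_primes_inter => i; have [P0 _ _ Pp] := minimal_primes_prime i.
have : P i (a * (x - y)) by rewrite mulrBr e subrr.
by case/Pp => // /nPa.
Qed.

Lemma prj_iota0 i a : prj i (iota a) = 0 <-> P i a.
Proof. exact: (hKi i).1. Qed.

Lemma prj_unit i x : x \is a GRing.unit -> prj i x != 0.
Proof. by move=> ux; rewrite -unitfE rmorph_unit. Qed.

Lemma prj_inj0 h : (forall i, prj i h = 0) -> h = 0.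
Proof.
have [inj reg frac] := hK; move=> h0; have [a [s [/reg us e]]] := frac h.
suff a0 : a = 0 by rewrite e a0 rmorph0 mul0r.
apply: minimal_primes_inter => i; apply/prj_iota0.
have := h0 i; rewrite e rmorphM /= => /eqP; rewrite mulf_eq0 => /orP[/eqP//|].
by rewrite (negPf (prj_unit _ _)) // unitrV.
Qed.

Lemma separated_sum_unit (a : 'I_r -> O) :
  (forall i, ~ P i (a i) /\ forall j, j != i -> P j (a i)) ->
  iota (\sum_i a i) \is a GRing.unit.
Proof.
move=> aP; have [_ reg _] := hK; apply/reg/lreg_off_primes => i Ps.
have [P0 _ PD _] := minimal_primes_prime i; apply: (aP i).1.
have -> : a i = -1 * (\sum_(j | j != i) a j) + \sum_j a j.
  by rewrite [\sum_j a j](bigD1 i) //= mulN1r addrCA addNr addr0.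
apply: (PD) => //; apply: (big_ind (P i)) => // [x y Px Py|j ne].
  by rewrite -[x]mul1r; apply: PD.
by apply: (aP j).2; rewrite eq_sym.
Qed.

(** [K] is the whole product of the [Ki]: to realize [a / d] at the place [i]
    and [0] elsewhere, correct the denominator by elements that vanish on
    all minimal primes but one. *)
Lemma prj_component i z : exists h, prj i h = z /\ forall j, j != i -> prj j h = 0.
Proof.
have [b bP] := minimal_primes_separate.
have [a [d [fd ->]]] := (hKi i).2 z.
have nPd : ~ P i d by move=> /prj_iota0 e; rewrite /= e eqxx in fd.
pose s := \sum_j (if j == i then d * b i else b j).
have us : iota s \is a GRing.unit.
  apply: separated_sum_unit => j; case: eqP => [->|_]; last exact: bP.
  have [_ _ _ Pp] := minimal_primes_prime i; have [nPb Pb] := bP i.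
  by split=> [/Pp[]//|l /Pb]; apply: minimal_primesM.
have prj_s : prj i (iota s) = prj i (iota d) * prj i (iota (b i)).
  rewrite !rmorph_sum (bigD1 i) //= eqxx !rmorphM big1 ?addr0 // => j ne.
  by rewrite (negPf ne); apply/prj_iota0/(bP j).2; rewrite eq_sym.
exists (iota (a * b i) / iota s); split=> [|j ne].
  rewrite rmorph_div //= prj_s !rmorphM /=.
  rewrite -mulf_div divff ?mulr1 //; apply/eqP => /prj_iota0 Pb.
  by have [/(_ Pb)] := bP i.
rewrite rmorphM /= (_ : prj j _ = 0) ?mul0r //; apply/prj_iota0.
by apply: minimal_primesM; apply: (bP i).2.
Qed.

Lemma psi_const i c : psi i (prj i (sc c)) = @FracField.tofrac (fps 1 k) c%:A.
Proof. by have [_ e _] := hpsi i; rewrite -e. Qed.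

Lemma v_component i (n : int) : exists x,
  v i x = n%:E /\ forall j, j != i -> v j x = +oo%E.
Proof.
have [z vz] := laurent_val_surj k n; have [[g _ gK] _ _] := hpsi i.
have [h [hi hj]] := prj_component (g z); exists h; split; first by rewrite hi gK.
by move=> j /hj ->; rewrite rmorph0 laurent_val0.
Qed.

Lemma curve_product_valuation : product_valuation iota v.
Proof.
split.
- by move=> i x y; rewrite !rmorphM laurent_valM.
- by move=> i n x y; rewrite !rmorphD; apply: laurent_valD.
- by move=> i; rewrite !rmorph0 laurent_val0.
- move=> i x; have [->|x0] := eqVneq (psi i (prj i x)) 0.
    by left; rewrite laurent_val0.
  by right; apply: laurent_val_fin.
- by move=> i c c0; rewrite psi_const laurent_val_const.
- move=> i x y n nx vy; have [c hc] := laurent_residue_div nx vy.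
  by exists c; rewrite !rmorphB !rmorphM psi_const.
- move=> x vx; apply: prj_inj0 => i; apply: (fmorph_inj (psi i)); rewrite rmorph0.
  by apply: contrapT => /eqP /laurent_val_fin[n]; rewrite vx.
- exact: v_component.
- have /choice[e eP] : forall i, exists h,
      prj i h = 1 /\ forall j, j != i -> prj j h = 0.
    by move=> i; apply: prj_component.
  exists e; split.
    apply/eqP; rewrite -subr_eq0; apply/eqP/prj_inj0 => i.
    rewrite rmorphB rmorph_sum rmorph1 /= (bigD1 i) //= (eP i).1.
    rewrite big1 ?addr0 ?subrr //.
    by move=> j ne; apply: (eP j).2; rewrite eq_sym.
  move=> i; rewrite (eP i).1 rmorph1; split.
    by rewrite -tofrac1 -[1]scale1r laurent_val_const ?oner_neq0.
  by move=> j ne; rewrite (eP i).2 // rmorph0 laurent_val0.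
Qed.

Let pv := curve_product_valuation.

(** The product of monic equations for the components of [h] is an equation for
    [h], since [K] embeds in the product of the [Ki]. *)
Lemma integral_closureE : integral_closure iota = filtration v setT 0.
Proof.
have intP i h : integralOver (prj i \o iota) (prj i h) <-> (0 <= v i h)%E.
  by have [_ _ e] := hpsi i; rewrite e laurent_val_ge0.
apply/seteqP; split=> [h int|h [_ h0]].
  by split=> // i; rewrite pointE; apply/intP; apply: integral_rmorph.
have /choice[p pP] : forall i, exists p : {poly O},
    p \is monic /\ root (map_poly (prj i \o iota) p) (prj i h).
  by move=> i; have := h0 i; rewrite pointE => /intP[p mp rp]; exists p.
exists (\prod_i p i); first by apply: monic_prod => i _; case: (pP i).
apply/eqP/prj_inj0 => i; rewrite -horner_map -map_poly_comp rmorph_prod horner_prod.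
rewrite (bigD1 i) //=; have [_ /eqP ->] := pP i; exact: mul0r.
Qed.

Lemma range_integral : R `<=` filtration v setT 0.
Proof. by rewrite -integral_closureE => _ [a _ <-]; apply: integral_id. Qed.

Section MaximalIdeal.
Variable M : set O.
Hypothesis M_ideal : idealr_closed [in M].
Hypothesis M_residue : forall x, exists c : k, M (x - c%:A).
Hypothesis M_complete : adically_complete M.

Lemma max_idealM x y : M y -> M (x * y).
Proof.
have /idealrP[M0 _ MD] := M_ideal => My.
by rewrite -[_ * _]addr0; apply: MD.
Qed.

(** An element of [M] with value [0] at some branch would differ from a nonzero
    constant by an element of positive value, but this difference is a unit. *)
Lemma max_ideal_val_gt0 z i : M z -> (1%:E <= v i (iota z))%E.
Proof.
move=> Mz; have [_ /(_ i)] := range_integral (imageT iota z); rewrite pointE => z0.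
have [c hc] := pv_residue pv z0 (val_one pv i); rewrite add0r mulr1 in hc.
have [c0|c0] := eqVneq c 0; first by move: hc; rewrite c0 scale0r rmorph0 subr0.
have [w ew] := complete_geometric M_ideal M_complete (max_idealM (c^-1%:A) Mz).
have : (1%:E <= v i (iota 1%R))%E.
  rewrite -ew rmorphM -[X in (X%:E <= _)%E]addr0; apply: (val_geM pv); last first.
    by have [_ /(_ i)] := range_integral (imageT iota w); rewrite pointE.
  have -> : iota (1 - c^-1%:A * z) = sc (- c^-1) * (iota z - sc c).
    rewrite mulrBr -scM mulNr mulVf // scaleN1r rmorphN1 opprK.
    by rewrite scaleNr rmorphN mulNr rmorphB rmorphM rmorph1 addrC.
  exact: (val_ge_scale pv).
by rewrite rmorph1 (val_one pv) lee_fin.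
Qed.

(** Otherwise [O / P i] would be [k], and all the values at [i] would be [0]
    or [+oo]. *)
Lemma max_ideal_off_prime i : exists2 z, M z & ~ P i z.
Proof.
apply: contrapT => no.
have val_range a : v i (iota a) = 0%E \/ v i (iota a) = +oo%E.
  have [c Mc] := M_residue a.
  have e : prj i (iota a) = prj i (sc c).
    apply/eqP; rewrite -subr_eq0 -!rmorphB; apply/eqP/prj_iota0.
    by apply: contrapT => nP; apply: no; exists (a - c%:A).
  rewrite e; have [->|c0] := eqVneq c 0; last by left; apply: (pv_const pv).
  by right; rewrite scale0r !rmorph0 laurent_val0.
have [_ reg frac] := hK; have [h [vh _]] := v_component i 1.
have [a [s [/reg us eh]]] := frac h; have [n vs] := val_unit pv i us.
have va : v i (iota a) = (1 + n)%:E by rewrite EFinD -vh -vs -(pvM pv) eh divrK.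
case: (val_range s); rewrite vs // => -[n0]; move: va; rewrite n0.
by case: (val_range a) => ->.
Qed.

Lemma max_ideal_unit : exists2 x, M x & iota x \is a GRing.unit.
Proof.
have [b bP] := minimal_primes_separate.
have /choice[z zP] : forall i, exists z, M z /\ ~ P i z.
  by move=> i; have [z Mz nP] := max_ideal_off_prime i; exists z.
have /idealrP[M0 _ MD] := M_ideal.
exists (\sum_i b i * z i).
  apply: (big_ind M) => // [x y Mx My|i _]; first by rewrite -[x]mul1r; apply: MD.
  by apply: max_idealM; case: (zP i).
apply: separated_sum_unit => i; have [_ _ _ Pp] := minimal_primes_prime i.
have [nb Pb] := bP i; have [_ nz] := zP i; split=> [/Pp[]//|j /Pb].
by rewrite mulrC; apply: minimal_primesM.
Qed.

Lemma max_ideal_local x : R x -> exists d, filtration v R [ffun=> 1] (x - sc d).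
Proof.
case=> a _ <-; have [c Mc] := M_residue a; exists c; rewrite -rmorphB.
by split=> [|i]; [exists (a - c%:A) | rewrite ffunE; apply: max_ideal_val_gt0].
Qed.

Lemma curve_closure_conductor : exists d, filtration v setT d `<=` R.
Proof.
have [x Mx ux] := max_ideal_unit; have [_ reg frac] := hK.
apply: (closure_conductor pv max_idealM M_complete _ range_integral Mx ux).
  by move=> z Mz i; apply: max_ideal_val_gt0.
by move=> y; have [a [s [/reg us ->]]] := frac y; exists a, s.
Qed.

End MaximalIdeal.

(** An element with finite values has no zero component. *)
Lemma value_semigroupE : value_semigroup iota v prj = value_set iota v.
Proof.
apply/seteqP; split=> [a [x _ vx]|a [_ [x _ <-] vx]].
  by exists (iota x) => //; exists x.
exists x => // -[i pi0]; have := vx i.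
by rewrite pi0 rmorph0 laurent_val0.
Qed.

End CurveValuation.

Theorem theorem25 (k : closedFieldType) (O : comAlgType k)
    (hO : algebroid_curve O)
    (r : nat) (P : 'I_r -> set O) (hP : minimal_primes_enum P)
    (K : comUnitRingType) (iota : {rmorphism O -> K})
    (hK : total_fraction_ring iota)
    (Ki : 'I_r -> fieldType) (prj : forall i, {rmorphism K -> Ki i})
    (hKi : forall i, fraction_field_mod (P i) (prj i \o iota))
    (psi : forall i, {rmorphism Ki i -> laurent k})
    (hpsi : forall i, normalization_iso (prj i \o iota) (psi i)) :
  let v i h := laurent_val (psi i (prj i h)) in
  let c := conductor (value_semigroup iota v prj) in
  (forall I : set K, fractional_ideal iota I ->
     forall (alpha : {ffun 'I_r -> int}) (i : 'I_r),
       (quotient_length iota (filtration v I alpha)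
                             (filtration v I (alpha + std_basis i)%R)
        + quotient_length iota
            (filtration v (dual iota I) (c - alpha - std_basis i)%R)
            (filtration v (dual iota I) (c - alpha)%R))%E = 1%:E)
  <-> gorenstein iota.
Proof.
move=> v c; have pv := curve_product_valuation hO hP hK hKi hpsi.
have [M [maxM resM complM]] := curve_local_complete hO.
have iM : idealr_closed [in M] by have [] := (maxM M).2 erefl.
have R0 := range_integral hO hP hK hKi hpsi.
have [d dR] := curve_closure_conductor hO hP hK hKi hpsi iM resM complM.
have [c' [cR no_jump isc]] := conductor_exists pv R0 dR.
have ec : c = c'.
  apply: (@is_conductor_unique _ (value_set iota v)) => //.
  by rewrite /c /conductor value_semigroupE; apply: (xgetI 0 isc).
rewrite ec; have [_ reg _] := hK.
apply: (gorenstein_length pv reg R0) => //.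
  exact: (max_ideal_local hO hP hK hKi hpsi iM resM complM).
exact: (integral_closureE hO hP hK hKi hpsi).
Qed.
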